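(* For every nonnegative integer $n$, $a(49n+15)\equiv a(49n+29)\equiv a(49n+36)\equiv a(49n+43)\equiv 0 \pmod 7$.
   Context: Let $(q;q)_\infty=\prod_{n=1}^\infty(1-q^n)$ and $(q^2;q^2)_\infty=\prod_{n=1}^\infty(1-q^{2n})$. The number of cubic partitions $a(n)$ is defined for $n\ge 0$ by the generating function $\sum_{n=0}^\infty a(n)q^n=\frac{1}{(q;q)_\infty(q^2;q^2)_\infty}$; equivalently, $a(n)$ is the number of pairs of partitions $(\lambda,\mu)$ with $|\lambda|+|\mu|=n$ and all parts of $\mu$ even. *)

(* Defs.v *)
From mathcomp Require Import all_boot all_order all_algebra.

Set Implicit Arguments.
Unset Strict Implicit.
Unset Printing Implicit Defensive.

Import Order.TTheory GRing.Theory Num.Theory.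
Local Open Scope ring_scope.

(* Formal power series in q over the integers, as coefficient sequences. *)
Definition fps := nat -> int.

Definition fps_one : fps := fun n => (n == 0%N)%:R.

Definition fps_mul (f g : fps) : fps :=
  fun n => \sum_(i < n.+1) f i * g (n - i)%N.

(* The first n.+1 coefficients of 1/f, obtained by solving f * g = 1 degree by
   degree; meaningful when f 0 is a unit (see fps_mulV). *)
Fixpoint fps_inv_seq (f : fps) (n : nat) : seq int :=
  if n is m.+1 then
    let s := fps_inv_seq f m in
    rcons s (- (f 0%N)^-1 * \sum_(i < m.+1) f (m.+1 - i)%N * s`_i)
  else [:: (f 0%N)^-1].

Definition fps_inv (f : fps) : fps := fun n => (fps_inv_seq f n)`_n.

(* (q^d; q^d)_oo = \prod_(k >= 1) (1 - q^(d k)) for d > 0.  Only the factors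
   with k <= n affect the coefficient of q^n (see qpochE). *)
Definition qpoch (d : nat) : fps :=
  fun n => (\prod_(1 <= k < n.+1) (1 - 'X^(d * k)) : {poly int})`_n.

Definition cubic_partitions : fps := fps_inv (fps_mul (qpoch 1) (qpoch 2)).

Lemma qpochE (d n N : nat) : (0 < d)%N -> (n <= N)%N ->
  qpoch d n = (\prod_(1 <= k < N.+1) (1 - 'X^(d * k)) : {poly int})`_n.
Proof.
move=> d_gt0; elim: N => [|N IHN]; first by rewrite leqn0 => /eqP->.
rewrite leq_eqVlt => /predU1P[-> // | lt_nN].
rewrite big_nat_recr //= mulrBr mulr1 coefB coefMXn IHN //.
by rewrite (leq_trans lt_nN (leq_pmull _ d_gt0)) subr0.
Qed.

Lemma size_fps_inv_seq f n : size (fps_inv_seq f n) = n.+1.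
Proof. by elim: n => //= n IHn; rewrite size_rcons IHn. Qed.

Lemma nth_fps_inv_seq f n i : (i <= n)%N -> (fps_inv_seq f n)`_i = fps_inv f i.
Proof.
elim: n => [|n IHn]; first by rewrite leqn0 => /eqP->.
rewrite leq_eqVlt => /predU1P[-> // | lt_in] /=.
by rewrite nth_rcons size_fps_inv_seq lt_in IHn.
Qed.

Lemma fps_mulV f : f 0%N \is a GRing.unit -> fps_mul f (fps_inv f) =1 fps_one.
Proof.
move=> Uf [|n]; first by rewrite /fps_mul big_ord1 /fps_inv /= divrr.
rewrite /fps_mul big_ord_recl /= {1}/fps_inv /= nth_rcons size_fps_inv_seq.
rewrite ltnn eqxx mulNr mulrN mulVKr // addrC.
rewrite /fps_one /=; apply/eqP; rewrite subr_eq0; apply/eqP.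
rewrite (reindex_inj rev_ord_inj) /=; apply: eq_bigr => i _.
have le_in : (i <= n)%N by rewrite -ltnS.
by rewrite nth_fps_inv_seq // /bump add1n !subSS subSn // subKn.
Qed.

Lemma cubic_partitionsP :
  fps_mul (fps_mul (qpoch 1) (qpoch 2)) cubic_partitions =1 fps_one.
Proof.
apply: fps_mulV.
by rewrite /fps_mul big_ord1 /qpoch !big_geq // !coef1 mulr1 unitr1.
Qed.

(* Main.v *)
(* Everything takes place in F_7[[q]], with Theta = q d/dq (theta below),
   E_d = (q^d; q^d)_oo (euler below), x = E_1^16 / E_2^8, y = q E_2^16 / E_1^8,
   A = 1 + 24 Theta(log E_2) - 24 Theta(log E_1) = Theta(log(y / x)) and
   P = 1 + 24 Theta(log E_1).

   (1) A^2 = x + 64 y, over every field of characteristic <> 2.  Gauss's theta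
   series E_1^2 / E_2 is supported on squares, which yields
   theta_3(q)^2 + theta_4(q)^2 = 2 theta_3(q^2)^2, then Jacobi's quartic relation
   between thetas.  By the latter A^2 / (x + 64 y) is invariant under q -> q^2,
   hence constant.

   (2) By Jacobi's identity for E_1^3 the series E_1^3 is supported modulo 7 on the
   n such that (n + 1)^3 = 1, i.e. n = 0, 1, 3 mod 7.  Read as differential
   equations for E_1^3 and E_2^3, this and (1) imply A (x - y) = 1 and that P is a
   Laurent polynomial in A.

   (3) It follows that f = E_1^6 E_2^6 satisfies
   f - (Theta + 6)^6 f = x y (x + y)^7 f = q (E_1^2 E_2^2 (x + y))^7, and the left
   side is the part of f with exponents 1 mod 7.  Dividing by (E_1 E_2)^7, a series
   in q^7, gives
   sum_k a(7k+1) q^k = E_1 E_2 (x + y) = E_1^3 (E_1^2/E_2)^7 + q E_2^3 (E_2^2/E_1)^7,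
   which by (2) has no term q^k with k = 2, 4, 5, 6 mod 7. *)

From HB Require Import structures.
Require Import Defs.
From mathcomp Require Import all_boot all_order all_algebra.
From mathcomp Require Import boolp finfield.
From mathcomp Require Import zify ring.

Set Implicit Arguments.
Unset Strict Implicit.
Unset Printing Implicit Defensive.

Import GRing.Theory.
Local Open Scope ring_scope.

(** * The ring of formal power series *)

Definition series (F : comNzRingType) : Type := nat -> F.

(** Equality and choice are classical, so that Leibniz equality of coefficient sequences serves as
    the equality of the ring. *)
HB.instance Definition _ (F : comNzRingType) := gen_eqMixin (series F).
HB.instance Definition _ (F : comNzRingType) := gen_choiceMixin (series F).

Lemma seriesP (F : comNzRingType) (f g : series F) : (forall n, f n = g n) -> f = g.
Proof. by move=> fg; apply: funext. Qed.

Section SeriesRing.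
Variable F : comNzRingType.
Implicit Types f g h : series F.

Definition ser_zero : series F := fun=> 0.
Definition ser_add f g : series F := fun n => f n + g n.
Definition ser_opp f : series F := fun n => - f n.

Fact ser_addA : associative ser_add.
Proof. by move=> f g h; apply: seriesP => n; rewrite /ser_add addrA. Qed.
Fact ser_addC : commutative ser_add.
Proof. by move=> f g; apply: seriesP => n; rewrite /ser_add addrC. Qed.
Fact ser_add0 : left_id ser_zero ser_add.
Proof. by move=> f; apply: seriesP => n; rewrite /ser_add add0r. Qed.
Fact ser_addN : left_inverse ser_zero ser_opp ser_add.
Proof. by move=> f; apply: seriesP => n; rewrite /ser_add addNr. Qed.

HB.instance Definition _ :=
  GRing.isZmodule.Build (series F) ser_addA ser_addC ser_add0 ser_addN.

Definition ser_one : series F := fun n => (n == 0)%:R.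
Definition ser_mul f g : series F := fun n => \sum_(i < n.+1) f i * g (n - i)%N.

Definition trunc N f : {poly F} := \poly_(i < N) f i.

(** A coefficient of a product only sees truncations of the factors, so the ring laws and the
    multiplicativity of [sqsub] are inherited from polynomials. *)
Lemma ser_mul_trunc f g N n : (n < N)%N ->
  ser_mul f g n = (trunc N f * trunc N g)`_n.
Proof.
move=> nN; rewrite coefM; apply: eq_bigr => i _.
have iN : (i < N)%N by apply: leq_ltn_trans nN; rewrite -ltnS.
by rewrite !coef_poly iN (leq_ltn_trans (leq_subr _ _) nN).
Qed.

Lemma coef_mul_eq (p p' r r' : {poly F}) n :
    (forall i, (i <= n)%N -> p`_i = p'`_i) ->
    (forall i, (i <= n)%N -> r`_i = r'`_i) -> (p * r)`_n = (p' * r')`_n.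
Proof.
move=> pp' rr'; rewrite !coefM; apply: eq_bigr => i _.
by rewrite pp' ?rr' ?leq_subr // -ltnS.
Qed.

Fact ser_mulA : associative ser_mul.
Proof.
move=> f g h; apply: seriesP => n.
have tE N u v i : (i <= N)%N ->
    (trunc N.+1 (ser_mul u v))`_i = (trunc N.+1 u * trunc N.+1 v)`_i.
  by move=> iN; rewrite coef_poly ltnS iN; apply: ser_mul_trunc.
rewrite !(@ser_mul_trunc _ _ n.+1) //.
transitivity ((trunc n.+1 f * (trunc n.+1 g * trunc n.+1 h))`_n).
  by apply: coef_mul_eq => // i; apply: tE.
by rewrite mulrA; apply: coef_mul_eq => // i /tE->.
Qed.
Fact ser_mulC : commutative ser_mul.
Proof.
by move=> f g; apply: seriesP => n; rewrite !(@ser_mul_trunc _ _ n.+1) // mulrC.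
Qed.
Fact ser_mul1 : left_id ser_one ser_mul.
Proof.
move=> f; apply: seriesP => n; rewrite /ser_mul big_ord_recl mul1r subn0.
by rewrite big1 ?addr0 // => i _; rewrite /ser_one mul0r.
Qed.
Fact ser_mulDl : left_distributive ser_mul ser_add.
Proof.
move=> f g h; apply: seriesP => n; rewrite /ser_mul /ser_add -big_split.
by apply: eq_bigr => i _; rewrite mulrDl.
Qed.
Fact ser_one_neq0 : ser_one != ser_zero.
Proof.
apply/eqP => /(congr1 (fun f : series F => f 0%N)) /eqP.
by rewrite /ser_one /ser_zero oner_eq0.
Qed.

HB.instance Definition _ := GRing.Zmodule_isComNzRing.Build (series F)
  ser_mulA ser_mulC ser_mul1 ser_mulDl ser_one_neq0.

Lemma coef_ser1 n : (1 : series F) n = (n == 0)%:R. Proof. by []. Qed.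
Lemma coef_serD f g n : (f + g) n = f n + g n. Proof. by []. Qed.
Lemma coef_serN f n : (- f) n = - f n. Proof. by []. Qed.
Lemma coef_serB f g n : (f - g) n = f n - g n. Proof. by []. Qed.
Lemma coef_serM f g n : (f * g) n = \sum_(i < n.+1) f i * g (n - i)%N.
Proof. by []. Qed.
Lemma coef_serM_trunc f g N n : (n < N)%N ->
  (f * g) n = (trunc N f * trunc N g)`_n.
Proof. exact: ser_mul_trunc. Qed.
Lemma coef_serMn f k n : (f *+ k) n = f n *+ k.
Proof. by elim: k => [|k IH]; rewrite ?mulr0n // !mulrS coef_serD IH. Qed.
Lemma coef_ser_nat k n : (k%:R : series F) n = if n == 0%N then k%:R else 0.
Proof. by rewrite coef_serMn coef_ser1; case: eqP; rewrite ?mul0rn. Qed.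
Lemma coef_ser_sum I (r : seq I) (P : pred I) (G : I -> series F) n :
  (\sum_(i <- r | P i) G i) n = \sum_(i <- r | P i) G i n.
Proof. exact: (big_morph (fun f : series F => f n)). Qed.
Lemma coef_serM0 f g : (f * g) 0%N = f 0%N * g 0%N.
Proof. by rewrite coef_serM big_ord1. Qed.
Lemma coef_serM1 f g : (f * g) 1%N = f 0%N * g 1%N + f 1%N * g 0%N.
Proof. by rewrite coef_serM !big_ord_recr big_ord0 /= add0r. Qed.
Lemma coef_serX0 f k : (f ^+ k) 0%N = f 0%N ^+ k.
Proof. by elim: k => [|k IH]; rewrite // !exprS coef_serM0 IH. Qed.

Lemma coef_ser_natM k f n : (k%:R * f) n = k%:R * f n.
Proof. by rewrite mulr_natl coef_serMn mulr_natl. Qed.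

End SeriesRing.

(** * The derivation q d/dq and the substitutions q -> q^2 and q -> -q *)

Section Morphisms.
Variable F : comNzRingType.
Implicit Types (f g h : series F) (p : {poly F}).

Definition ser_of_poly p : series F := fun n => p`_n.

Fact ser_of_poly_zmod : zmod_morphism ser_of_poly.
Proof. by move=> p r; apply: seriesP => n; rewrite /ser_of_poly coefB. Qed.
Fact ser_of_poly_monoid : monoid_morphism ser_of_poly.
Proof.
split=> [|p r]; apply: seriesP => n; first by rewrite /ser_of_poly coef1.
by rewrite /ser_of_poly coefM.
Qed.
HB.instance Definition _ :=
  GRing.isZmodMorphism.Build {poly F} (series F) ser_of_poly ser_of_poly_zmod.
HB.instance Definition _ :=
  GRing.isMonoidMorphism.Build {poly F} (series F) ser_of_poly ser_of_poly_monoid.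

Definition ser_q : series F := ser_of_poly 'X.
Local Notation q := ser_q.

Lemma ser_of_polyXn k : ser_of_poly 'X^k = q ^+ k.
Proof. by rewrite rmorphXn. Qed.

Lemma coef_serXnM k f n :
  (q ^+ k * f) n = if (n < k)%N then 0 else f (n - k)%N.
Proof.
rewrite coef_serM -ser_of_polyXn /ser_of_poly.
case: ltnP => [nk|kn].
  apply: big1 => i _; rewrite coefXn; case: eqP => [ik|]; last by rewrite mul0r.
  by have := ltn_ord i; rewrite ik ltnS leqNgt nk.
rewrite (bigD1 (Ordinal (kn : k < n.+1)%N)) //= coefXn eqxx mul1r big1 ?addr0 //.
by move=> i /negPf ik; rewrite coefXn -[_ == k]/(i == Ordinal (kn : k < n.+1)%N) ik mul0r.
Qed.

Lemma coef_serXM f n : (q * f) n.+1 = f n.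
Proof. by have := coef_serXnM 1 f n.+1; rewrite expr1 => ->; rewrite subn1. Qed.

Lemma coef_serXM0 f : (q * f) 0%N = 0.
Proof. by have := coef_serXnM 1 f 0; rewrite expr1. Qed.

Lemma mulXnI k : injective (fun f => q ^+ k * f).
Proof.
move=> f g fg; apply: seriesP => n.
have := congr1 (fun f : series F => f (n + k)%N) fg.
by rewrite /= !coef_serXnM ltnNge leq_addl addnK.
Qed.

Definition theta f : series F := fun n => n%:R * f n.

Lemma coef_theta f n : theta f n = n%:R * f n. Proof. by []. Qed.

Fact theta_zmod : zmod_morphism theta.
Proof. by move=> f g; apply: seriesP => n; rewrite /theta coef_serB mulrBr. Qed.
HB.instance Definition _ :=
  GRing.isZmodMorphism.Build (series F) (series F) theta theta_zmod.

Lemma thetaM f g : theta (f * g) = theta f * g + f * theta g.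
Proof.
apply: seriesP => n; rewrite coef_theta coef_serD !coef_serM mulr_sumr -big_split.
apply: eq_bigr => i _; rewrite /= !coef_theta.
have -> : n%:R = i%:R + (n - i)%:R :> F by rewrite -natrD subnKC // -ltnS.
by ring.
Qed.

Lemma theta1 : theta 1 = 0.
Proof.
by apply: seriesP => -[|n]; rewrite coef_theta coef_ser1 ?mul0r ?mulr0.
Qed.

Lemma theta_q : theta q = q.
Proof.
apply: seriesP => n; rewrite coef_theta /q /ser_of_poly coefX.
by case: eqP => [->|]; rewrite ?mulr1 ?mulr0.
Qed.

Lemma thetaX f k : theta (f ^+ k) = k%:R * f ^+ k.-1 * theta f.
Proof.
elim: k => [|[|k] IH]; first by rewrite expr0 theta1 !mul0r.
  by rewrite /= !expr1 expr0 !mul1r.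
rewrite [f ^+ k.+2]exprS thetaM IH /= !exprS -[k.+2]addn1 natrD; ring.
Qed.

Lemma theta_nat k : theta k%:R = 0.
Proof. by rewrite raddfMn /= theta1 mul0rn. Qed.

Lemma theta_natM k f : theta (k%:R * f) = k%:R * theta f.
Proof. by rewrite !mulr_natl raddfMn. Qed.

(** The substitution q -> q^2. *)
Definition sqsub f : series F := fun n => if odd n then 0 else f n./2.

Lemma coef_sqsub f n : sqsub f n = if odd n then 0 else f n./2.
Proof. by []. Qed.

Fact sqsub_zmod : zmod_morphism sqsub.
Proof.
by move=> f g; apply: seriesP => n; rewrite coef_serB !coef_sqsub; case: odd;
   rewrite ?subr0.
Qed.

Lemma sqsub_trunc f N n : (n < N)%N -> sqsub f n = (trunc N f \Po 'X^2)`_n.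
Proof.
move=> nN; rewrite coef_comp_poly_Xn // dvdn2 coef_sqsub; case: odd => //=.
by rewrite coef_poly divn2; case: ltnP => //; lia.
Qed.

Fact sqsub_monoid : monoid_morphism sqsub.
Proof.
split=> [|f g]; apply: seriesP => n.
  by rewrite coef_sqsub !coef_ser1; case: n => [|[|n]] //=; rewrite if_same.
rewrite (@coef_serM_trunc _ _ _ n.+1) //.
transitivity (((trunc n.+1 f * trunc n.+1 g) \Po 'X^2)`_n).
  rewrite coef_comp_poly_Xn // dvdn2 coef_sqsub; case: odd => //=.
  by rewrite (@coef_serM_trunc _ _ _ n.+1) ?divn2 //; lia.
rewrite comp_polyM; apply: coef_mul_eq => i iN.
  by rewrite coef_poly ltnS iN (@sqsub_trunc _ n.+1).
by rewrite coef_poly ltnS iN (@sqsub_trunc _ n.+1).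
Qed.
HB.instance Definition _ :=
  GRing.isZmodMorphism.Build (series F) (series F) sqsub sqsub_zmod.
HB.instance Definition _ :=
  GRing.isMonoidMorphism.Build (series F) (series F) sqsub sqsub_monoid.

Lemma sqsub_q : sqsub q = q ^+ 2.
Proof.
apply: seriesP => n; rewrite coef_sqsub -ser_of_polyXn /q /ser_of_poly coefX coefXn.
case: ifP => [on|en]; first by case: eqP => // n2; rewrite n2 in on.
by congr (_ %:R); lia.
Qed.

Lemma theta_sqsub f : theta (sqsub f) = 2 * sqsub (theta f).
Proof.
apply: seriesP => n; rewrite coef_ser_natM coef_theta !coef_sqsub.
case: ifP => on; rewrite ?mulr0 // coef_theta mulrA -natrM.
by congr (_%:R * _); lia.
Qed.

(** The substitution q -> -q. *)
Definition negsub f : series F := fun n => (-1) ^+ n * f n.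

Lemma coef_negsub f n : negsub f n = (-1) ^+ n * f n. Proof. by []. Qed.

Fact negsub_zmod : zmod_morphism negsub.
Proof. by move=> f g; apply: seriesP => n; rewrite coef_serB !coef_negsub mulrBr. Qed.
Fact negsub_monoid : monoid_morphism negsub.
Proof.
split=> [|f g]; apply: seriesP => n.
  by rewrite coef_negsub coef_ser1; case: n => [|n]; rewrite ?mulr0 ?expr0 ?mul1r.
rewrite coef_negsub !coef_serM mulr_sumr; apply: eq_bigr => i _.
rewrite !coef_negsub -[in (-1) ^+ n](@subnKC i n) ?exprD; last by rewrite -ltnS.
by ring.
Qed.
HB.instance Definition _ :=
  GRing.isZmodMorphism.Build (series F) (series F) negsub negsub_zmod.
HB.instance Definition _ :=
  GRing.isMonoidMorphism.Build (series F) (series F) negsub negsub_monoid.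

Lemma negsub_sqsub f : negsub (sqsub f) = sqsub f.
Proof.
apply: seriesP => n; rewrite coef_negsub coef_sqsub -signr_odd.
by case: odd; rewrite ?mulr0 ?mul1r.
Qed.

Lemma negsub_q : negsub q = - q.
Proof.
apply: seriesP => n; rewrite coef_negsub coef_serN /q /ser_of_poly coefX.
by case: eqP => [->|]; rewrite ?mulr0 ?oppr0 // expr1 mulr1.
Qed.

Lemma ser_mulI f g h : f 0%N = 1 -> f * g = f * h -> g = h.
Proof.
move=> f0 /eqP; rewrite -subr_eq0 -mulrBr => /eqP fd.
apply/eqP; rewrite -subr_eq0; apply/eqP; move: (g - h) fd => d fd.
apply: seriesP; elim/ltn_ind => n IH.
have := congr1 (fun f : series F => f n) fd.
rewrite /= coef_serM big_ord_recl subn0 f0 mul1r big1 ?addr0 //.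
by move=> i _; rewrite lift0 IH ?mulr0 //; have := ltn_ord i; lia.
Qed.

End Morphisms.

(** * The q-binomial theorem and Euler products *)

Section QBinomial.
Variable K : comNzRingType.
Implicit Types (Q a b : K).

Definition qprod Q n : K := \prod_(i < n) (1 - Q ^+ i.+1).

Lemma qprod0 Q : qprod Q 0 = 1. Proof. exact: big_ord0. Qed.
Lemma qprodS Q n : qprod Q n.+1 = qprod Q n * (1 - Q ^+ n.+1).
Proof. exact: big_ord_recr. Qed.

Fixpoint qbin Q m k : K :=
  match m, k with
  | _, 0%N => 1
  | 0%N, _.+1 => 0
  | m'.+1, k'.+1 => qbin Q m' k' + Q ^+ k * qbin Q m' k
  end.

Lemma qbin0 Q m : qbin Q m 0 = 1. Proof. by case: m. Qed.
Lemma qbinS Q m k : qbin Q m.+1 k.+1 = qbin Q m k + Q ^+ k.+1 * qbin Q m k.+1.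
Proof. by []. Qed.

Lemma qbin_small Q m k : (m < k)%N -> qbin Q m k = 0.
Proof.
elim: m k => [|m IH] [|k] //; rewrite ltnS => mk.
by rewrite qbinS !IH ?mulr0 ?addr0 // ltnW.
Qed.

(** The quotient formula for Gaussian binomials, cleared of denominators. *)
Lemma qbin_qprod Q i j : qbin Q (i + j) i * (qprod Q i * qprod Q j) = qprod Q (i + j).
Proof.
move: {2}(i + j)%N (erefl (i + j)%N) => n; elim: n i j => [|n IH] i j.
  by case: i j => [|i] [|j] //= _; rewrite !qprod0 !mulr1.
case: i j => [|i] [|j] ijn //; rewrite ?add0n //.
- by rewrite qbin0 qprod0 !mul1r.
- rewrite addn0 in ijn *; case: ijn => ->; have := IH n 0%N; rewrite addn0 => /(_ erefl).
  rewrite qbinS (@qbin_small _ n n.+1) // mulr0 addr0 !qprodS qprod0 !mulr1 => IH'.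
  by rewrite mulrA IH'.
have ijn' : (i + j).+1 = n by move: ijn; rewrite addnS addSn => -[].
have e1 : qbin Q (i + j).+1 i * (qprod Q i * (qprod Q j * (1 - Q ^+ j.+1))) =
    qprod Q (i + j).+1 by rewrite -qprodS -addnS IH ?addnS.
have e2 : qbin Q (i + j).+1 i.+1 * (qprod Q i * (1 - Q ^+ i.+1) * qprod Q j) =
    qprod Q (i + j).+1 by rewrite -qprodS -addSn IH ?addSn.
have hQ : Q ^+ (i + j).+2 = Q ^+ i.+1 * Q ^+ j.+1 by rewrite -exprD addSn addnS.
rewrite addSn addnS qbinS [RHS]qprodS hQ.
rewrite [qprod Q i.+1]qprodS [qprod Q j.+1]qprodS.
(* The two terms of the Pascal rule recombine by 1 - Q^(i+j+2) = (1 - Q^(i+1)) + Q^(i+1) (1 -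
   Q^(j+1)). *)
transitivity
  (qbin Q (i + j).+1 i * (qprod Q i * (qprod Q j * (1 - Q ^+ j.+1))) * (1 - Q ^+ i.+1) +
   Q ^+ i.+1 * (1 - Q ^+ j.+1) *
     (qbin Q (i + j).+1 i.+1 * (qprod Q i * (1 - Q ^+ i.+1) * qprod Q j))).
  by ring.
by rewrite e1 e2; ring.
Qed.

(** Splitting off the factor i = 0 replaces [b] by [b * Q], hence the induction is over all [b]. The
    homogeneous form serves both a monomial [a] (Gauss) and a polynomial variable [a] (Jacobi). *)
Theorem qbinomial Q a b m :
  \prod_(i < m) (a + b * Q ^+ i) =
  \sum_(k < m.+1) qbin Q m k * Q ^+ 'C(k, 2) * b ^+ k * a ^+ (m - k).
Proof.
elim: m b => [|m IH] b; first by rewrite big_ord0 big_ord1 /= !mulr1.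
rewrite big_ord_recl expr0 mulr1.
under eq_bigr => i _ do rewrite lift0 exprS mulrA.
rewrite IH mulrDl [RHS]big_ord_recl qbin0 bin0n expr0 !mul1r subn0.
under [in RHS]eq_bigr => i _ do
  rewrite lift0 qbinS subSS binS bin1 exprD !mulrDl.
rewrite big_split [RHS]addrCA [LHS]addrC; congr (_ + _).
  rewrite mulr_sumr; apply: eq_bigr => i _; rewrite exprMn exprS; ring.
rewrite mulr_sumr big_ord_recl qbin0 bin0n !expr0 !mul1r subn0 -exprS; congr (_ + _).
under [LHS]eq_bigr => i _ do rewrite lift0.
rewrite [RHS]big_ord_recr /= qbin_small // mulr0 !mul0r addr0.
apply: eq_bigr => i _; rewrite binS bin1 exprD exprMn.
by have -> : (m - i = (m - i.+1).+1)%N; [have := ltn_ord i; lia | rewrite !exprS; ring].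
Qed.

End QBinomial.

Arguments qbin {K} Q m k : simpl never.

Lemma rmorph_qbin (K L : comNzRingType) (f : {rmorphism K -> L}) Q m k :
  f (qbin Q m k) = qbin (f Q) m k.
Proof.
elim: m k => [|m IH] [|k]; rewrite ?qbin0 ?rmorph1 ?rmorph0 //.
by rewrite !qbinS rmorphD rmorphM rmorphXn !IH.
Qed.

Lemma rmorph_qprod (K L : comNzRingType) (f : {rmorphism K -> L}) Q n :
  f (qprod Q n) = qprod (f Q) n.
Proof.
by rewrite rmorph_prod; apply: eq_bigr => i _; rewrite rmorphB rmorph1 rmorphXn.
Qed.

(* Locked because rewrite and ring would otherwise unfold Euler products when
   comparing subterms. *)
HB.lock Definition euler (F : comNzRingType) d : series F :=
  fun n => qprod (ser_q F ^+ d) n n.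

(** * Congruence modulo q^n and truncation of Euler products *)

Section Congruence.
Variable F : comNzRingType.
Implicit Types f g h : series F.
Local Notation q := (ser_q F).

Definition eqm n f g := forall i, (i < n)%N -> f i = g i.

Lemma eqmxx n f : eqm n f f. Proof. by []. Qed.
Lemma eqm_sym n f g : eqm n f g -> eqm n g f.
Proof. by move=> fg i /fg. Qed.
Lemma eqm_trans n f g h : eqm n f g -> eqm n g h -> eqm n f h.
Proof. by move=> fg gh i ni; rewrite fg ?gh. Qed.
Lemma eqm_le m n f g : eqm n f g -> (m <= n)%N -> eqm m f g.
Proof. by move=> fg mn i im; apply: fg; apply: leq_trans mn. Qed.

Lemma eqmM n f f' g g' : eqm n f f' -> eqm n g g' -> eqm n (f * g) (f' * g').
Proof.
move=> ff gg i ni; rewrite !coef_serM; apply: eq_bigr => j _.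
by rewrite ff ?gg //; have := ltn_ord j; lia.
Qed.

Lemma eqmX n f f' k : eqm n f f' -> eqm n (f ^+ k) (f' ^+ k).
Proof. by move=> ff; elim: k => // k IH; rewrite !exprS; apply: eqmM. Qed.

Lemma eqmXnM n k f g : eqm n f g -> eqm (k + n) (q ^+ k * f) (q ^+ k * g).
Proof.
by move=> fg i ikn; rewrite !coef_serXnM; case: ltnP => // ki; apply: fg; lia.
Qed.

Lemma eqm_mulI n f g h : f 0%N = 1 -> eqm n (f * g) (f * h) -> eqm n g h.
Proof.
move=> f0 fgh; elim/ltn_ind => i IH ni.
have := fgh i ni; rewrite !coef_serM !big_ord_recl subn0 f0 !mul1r.
have -> : \sum_(j < i) f (lift ord0 j) * g (i - lift ord0 j)%N =
          \sum_(j < i) f (lift ord0 j) * h (i - lift ord0 j)%N.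
  by apply: eq_bigr => j _; rewrite lift0 IH //; have := ltn_ord j; lia.
exact: addIr.
Qed.

Lemma eqm_sqsub n f g : eqm n f g -> eqm n (sqsub f) (sqsub g).
Proof. by move=> fg i ni; rewrite !coef_sqsub; case: odd => //; apply: fg; lia. Qed.

Lemma eqm_negsub n f g : eqm n f g -> eqm n (negsub f) (negsub g).
Proof. by move=> fg i ni; rewrite !coef_negsub fg. Qed.

Lemma eqm_ext f g (N : nat -> nat) :
  (forall n, (n <= N n)%N) -> (forall n, eqm (N n) f g) -> f = g.
Proof. by move=> leN fg; apply: seriesP => n; apply: (fg n.+1); apply: leN. Qed.

Lemma eqm_qprod d M N : (M <= N)%N -> eqm (d * M.+1) (qprod (q ^+ d) M) (qprod (q ^+ d) N).
Proof.
elim: N => [|N IH]; first by rewrite leqn0 => /eqP->; apply: eqmxx.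
rewrite leq_eqVlt => /predU1P[->|MN]; first exact: eqmxx.
move=> i iM; rewrite IH // qprodS mulrBr mulr1.
rewrite coef_serB -exprM mulrC coef_serXnM.
by rewrite (_ : (i < d * N.+1)%N) ?subr0 //; apply: (leq_trans iM); rewrite leq_mul2l MN orbT.
Qed.

Lemma eqm_euler n d N : (0 < d)%N -> (n <= d * N.+1)%N ->
  eqm n (euler F d) (qprod (q ^+ d) N).
Proof.
move=> d0 nN i /leq_trans/(_ nN) iN; rewrite euler.unlock.
case: (leqP i N) => [le_iN|lt_Ni]; first by apply: (eqm_qprod le_iN); nia.
by symmetry; apply: (eqm_qprod (ltnW lt_Ni)).
Qed.

Lemma euler0 d : euler F d 0%N = 1.
Proof. by rewrite euler.unlock qprod0. Qed.

Lemma sqsub_euler d : (0 < d)%N -> sqsub (euler F d) = euler F (d.*2).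
Proof.
move=> d0; apply: (@eqm_ext _ _ id) => // n.
apply: (@eqm_trans _ _ (qprod (q ^+ d.*2) n)); last first.
  by apply: eqm_sym; apply: eqm_euler; nia.
have -> : qprod (q ^+ d.*2) n = sqsub (qprod (q ^+ d) n).
  by rewrite rmorph_qprod rmorphXn /= sqsub_q -exprM mul2n.
by apply: eqm_sqsub; apply: eqm_euler; nia.
Qed.

(** The even exponents contribute E_2^2. The odd ones pair up as (1 - q^r) (1 + q^r) = 1 - q^(2r),
    and these factors times E_4 give E_2. With 2n factors in q and n in q^4 the identity is exact,
    so it is proved on finite products. *)
Lemma negsub_euler1 : negsub (euler F 1) * euler F 1 * euler F 4 = euler F 2 ^+ 3.
Proof.
apply: (@eqm_ext _ _ (fun n => n.*2.+1)) => [n|n]; first by lia.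
have eN d : (0 < d)%N -> eqm n.*2.+1 (euler F d) (qprod (q ^+ d) n.*2).
  by move=> d0; apply: eqm_euler; nia.
have eN' d : (1 < d)%N -> eqm n.*2.+1 (euler F d) (qprod (q ^+ d) n).
  by move=> d0; apply: eqm_euler; nia.
apply: (@eqm_trans _ _ (qprod (- q) n.*2 * qprod q n.*2 * qprod (q ^+ 4) n)).
  apply: eqmM; last exact: eN'.
  apply: eqmM; last by rewrite -[q]expr1; apply: eN.
  rewrite -negsub_q -rmorph_qprod; apply: eqm_negsub.
  by rewrite -[q]expr1; apply: eN.
have -> : qprod (- q) n.*2 * qprod q n.*2 * qprod (q ^+ 4) n =
          qprod (q ^+ 2) n.*2 * qprod (q ^+ 2) n ^+ 2.
  elim: n {eN eN'} => [|n IH]; first by rewrite !qprod0 !expr1n !mulr1.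
  rewrite doubleS !qprodS -!exprM.
  have -> : (- q) ^+ n.*2.+1 = - q ^+ n.*2.+1 by rewrite exprNn -signr_odd /= odd_double mulN1r.
  have -> : (- q) ^+ n.*2.+2 = q ^+ n.*2.+2 by rewrite exprNn -signr_odd /= odd_double mul1r.
  have -> : q ^+ (4 * n.+1) = (q ^+ n.+1) ^+ 4 by rewrite mulnC exprM.
  have -> : q ^+ (2 * n.+1) = (q ^+ n.+1) ^+ 2 by rewrite mulnC exprM.
  have -> : q ^+ (2 * n.*2.+1) = (q ^+ n.*2.+1) ^+ 2 by rewrite mulnC exprM.
  have -> : q ^+ n.*2.+2 = (q ^+ n.+1) ^+ 2 by rewrite -exprM; congr (_ ^+ _); lia.
  have -> : q ^+ (2 * n.*2.+2) = (q ^+ n.+1) ^+ 4 by rewrite -exprM; congr (_ ^+ _); lia.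
  transitivity ((qprod (- q) n.*2 * qprod q n.*2 * qprod (q ^+ 4) n) *
    ((1 - (q ^+ n.*2.+1) ^+ 2) * (1 - (q ^+ n.+1) ^+ 2) ^+ 2 * (1 - (q ^+ n.+1) ^+ 4))).
    by ring.
  by rewrite IH; ring.
rewrite exprS; apply: eqmM; first by apply: eqm_sym; apply: eN.
by apply: eqmX; apply: eqm_sym; apply: eN'.
Qed.

(** A Gaussian binomial tends to 1 / E_d when k and m - k both grow: in [qbin_qprod] all three
    finite products agree with E_d to the stated precision. *)
Lemma eqm_qbin d m k : (0 < d)%N -> (k <= m)%N ->
  eqm (d * (minn k (m - k)).+1) (qbin (q ^+ d) m k * euler F d) 1.
Proof.
move=> d0 km; set n := (d * _)%N.
have eN j : (minn k (m - k) <= j)%N -> eqm n (euler F d) (qprod (q ^+ d) j).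
  by move=> mj; apply: eqm_euler; rewrite // leq_mul2l ltnS mj orbT.
apply: (@eqm_mulI _ (euler F d)); first exact: euler0.
rewrite mulr1 mulrCA.
apply: (@eqm_trans _ _ (qprod (q ^+ d) m)); last by apply: eqm_sym; apply: eN; lia.
have := qbin_qprod (q ^+ d) k (m - k); rewrite subnKC // => <-.
by apply: eqmM => //; apply: eqmM; apply: eN; lia.
Qed.

End Congruence.

(** * Theta series of Gauss and Jacobi *)

Lemma double_bin2 k : (2 * 'C(k, 2) + k = k * k)%N.
Proof. by elim: k => // k IH; rewrite binS bin1; lia. Qed.

Lemma prod_expr_ord (K : comNzRingType) (x : K) n : \prod_(i < n) x ^+ i = x ^+ 'C(n, 2).
Proof.
elim: n => [|n IH]; first by rewrite big_ord0.
by rewrite big_ord_recr /= IH binS bin1 -exprD.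
Qed.

(** Completes the square in the q-binomial expansion. Subtraction is truncated, so one of the last
    two squares is 0 and their sum is |m - k|^2. *)
Lemma gauss_exponent n k : let m := n.+1 in (k <= m + m)%N ->
  (2 * 'C(k, 2) + (m + n) * (m + m - k) =
   2 * 'C(m, 2) + m * (m + n) + ((m - k) ^ 2 + (k - m) ^ 2))%N.
Proof.
move=> m km; have := double_bin2 k; have := double_bin2 m; rewrite -!mulnn {}/m in km *.
case: (leqP k n.+1) => [/subnKC|/ltnW/subnKC]; set j := (_ - _)%N => ej.
  by rewrite (_ : k - n.+1 = 0)%N; nia.
by rewrite (_ : n.+1 - k = 0)%N; nia.
Qed.

(** Ensures that replacing the Gaussian binomial by its limit in the term with exponent |m - k|^2
    causes no error below degree m. *)
Lemma gauss_bound m k : (k <= m + m)%N ->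
  (m <= (m - k) ^ 2 + (k - m) ^ 2 + 2 * (minn k (m + m - k)).+1)%N.
Proof.
move=> km; rewrite -!mulnn; case: (leqP k m) => [k_le|k_ge].
  rewrite (_ : k - m = 0)%N; last by lia.
  rewrite (_ : minn _ _ = m - (m - k))%N; last by lia.
  by move: (m - k)%N => j; nia.
rewrite (_ : m - k = 0)%N; last by lia.
rewrite (_ : minn _ _ = m - (k - m))%N; last by lia.
by move: (k - m)%N => j; nia.
Qed.

Lemma jacobi_bound n k : let m := n.*2.+1 in (k <= m)%N ->
  (n <= 'C(k - n, 2) + 'C((n - k).+1, 2) + (minn k (m - k)))%N.
Proof.
move=> m km; rewrite {}/m in km *.
have := double_bin2 (k - n); have := double_bin2 (n - k).+1.
case: (leqP k n) => [k_le|k_ge].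
  rewrite (_ : k - n = 0)%N; last by lia.
  rewrite (_ : minn _ _ = n - (n - k))%N; last by lia.
  by move: (n - k)%N => j; nia.
rewrite (_ : n - k = 0)%N; last by lia.
rewrite (_ : minn _ _ = n.+1 - (k - n))%N; last by lia.
by move: (k - n)%N => j; nia.
Qed.

(** The last bracket is the triangular number j (j - 1) / 2 for the integer j = k - n of either
    sign: one of its two terms is always 0. *)
Lemma jacobi_exponent n k : let m := n.*2.+1 in (k <= m)%N ->
  ('C(k, 2) + n * (m - k) =
   n + ('C(n, 2) + n * n) + ('C(k - n, 2) + 'C((n - k).+1, 2)))%N.
Proof.
move=> m km; have := double_bin2 k; have := double_bin2 n.
have := double_bin2 (k - n); have := double_bin2 (n - k).+1; rewrite {}/m in km *.
case: (leqP k n) => [/subnKC|/ltnW/subnKC]; set j := (_ - _)%N => ej.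
  by rewrite (_ : k - n = 0)%N; nia.
by rewrite (_ : n - k = 0)%N; nia.
Qed.

Section Theta.
Variable F : comNzRingType.
Implicit Types f g h : series F.
Local Notation q := (ser_q F).

Definition oddprod n : series F := \prod_(i < n) (1 - q ^+ i.*2.+1).

Lemma qprod_double n : qprod q n.*2 = oddprod n * qprod (q ^+ 2) n.
Proof.
rewrite /oddprod; elim: n => [|n IH]; first by rewrite !qprod0 big_ord0 mulr1.
rewrite doubleS !qprodS IH big_ord_recr -exprM.
by rewrite (_ : 2 * n.+1 = n.*2.+2)%N /=; [ring | lia].
Qed.

(** The odd exponent m + n = 2m - 1 lies between the even exponents 2i of the two halves; factoring
    out the lower power leaves one copy of [oddprod m] from each half. *)
Lemma prod_gauss n : let m := n.+1 in
  \prod_(i < m + m) (q ^+ (m + n) + -1 * (q ^+ 2) ^+ i) =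
  (-1) ^+ m * q ^+ (2 * 'C(m, 2) + m * (m + n)) * oddprod m ^+ 2.
Proof.
move=> m; rewrite big_split_ord (reindex_inj rev_ord_inj) /=.
under eq_bigr => i _.
  have -> : q ^+ (m + n) + -1 * (q ^+ 2) ^+ (m - i.+1) =
            -1 * (q ^+ 2) ^+ (m - i.+1) * (1 - q ^+ i.*2.+1).
    rewrite -!exprM (_ : m + n = 2 * (m - i.+1) + i.*2.+1)%N ?exprD; first by ring.
    by have := ltn_ord i; lia.
  over.
rewrite big_split /=.
under [X in _ * X = _]eq_bigr => i _.
  have -> : q ^+ (m + n) + -1 * (q ^+ 2) ^+ (m + i) =
            q ^+ (m + n) * (1 - q ^+ i.*2.+1).
    rewrite -!exprM (_ : 2 * (m + i) = m + n + i.*2.+1)%N ?exprD; first by ring.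
    by lia.
  over.
rewrite !big_split /= !prodr_const card_ord.
have -> : \prod_(i < m) (q ^+ 2) ^+ (m - i.+1) = (q ^+ 2) ^+ 'C(m, 2).
  by rewrite -prod_expr_ord [RHS](reindex_inj rev_ord_inj).
rewrite -/(oddprod m) -!exprM [(m * _)%N]mulnC (exprD _ (2 * _)); ring.
Qed.

(** Finite form of Gauss's identity E_1^2 / E_2 = sum over j in Z of (-1)^j q^(j^2): the q-binomial
    theorem in base q^2 applied to [prod_gauss], with a common monomial cancelled. *)
Lemma gauss_finite n : let m := n.+1 in
  oddprod m ^+ 2 = \sum_(k < (m + m).+1)
    (-1) ^+ (m + k) * qbin (q ^+ 2) (m + m) k * q ^+ ((m - k) ^ 2 + (k - m) ^ 2).
Proof.
move=> m; have := prod_gauss n; cbv zeta; rewrite -/m qbinomial.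
set s := (2 * _ + _)%N => e; apply: (@mulXnI _ s) => /=.
transitivity ((-1) ^+ m * ((-1) ^+ m * q ^+ s * oddprod m ^+ 2)).
  by rewrite !mulrA -expr2 sqrr_sign mul1r.
rewrite -e !mulr_sumr; apply: eq_bigr => k _.
have km : (k <= m + m)%N by rewrite -ltnS.
have -> : q ^+ (m + n) ^+ (m + m - k) = q ^+ ((m + n) * (m + m - k)) by rewrite exprM.
have ek := gauss_exponent km; rewrite -/m -/s in ek.
rewrite -exprM; transitivity ((-1) ^+ m * (-1) ^+ k * qbin (q ^+ 2) (m + m) k *
   q ^+ (2 * 'C(k, 2) + (m + n) * (m + m - k))).
  by rewrite (exprD _ (2 * _)); ring.
by rewrite ek (exprD _ s) (exprD _ m); ring.
Qed.

Lemma coef_square_support f : euler F 1 ^+ 2 = f * euler F 2 ->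
  forall n, (1 < n %% 4)%N -> f n = 0.
Proof.
move=> e n n4; set m := n.+1.
have e1 : eqm m (euler F 1) (oddprod m * qprod (q ^+ 2) m).
  by rewrite -qprod_double -[q]expr1; apply: eqm_euler; lia.
have e2 : eqm m (euler F 2) (qprod (q ^+ 2) m) by apply: eqm_euler; lia.
(* As E_1 is [oddprod m] times E_2 to this precision, E_1^2 / E_2 is [oddprod m ^+ 2] times E_2. *)
have e3 : eqm m f (oddprod m ^+ 2 * euler F 2).
  apply: (@eqm_mulI _ m (euler F 2)); first exact: euler0.
  rewrite mulrC -e; apply: eqm_trans (eqmX 2 e1) _.
  rewrite exprMn; have -> : euler F 2 * (oddprod m ^+ 2 * euler F 2) =
    oddprod m ^+ 2 * euler F 2 ^+ 2 by ring.
  by apply: eqmM => //; apply: eqmX; apply: eqm_sym.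
rewrite e3 // gauss_finite mulr_suml coef_ser_sum big1 // => k _; rewrite -/m.
have km : (k <= m + m)%N by rewrite -ltnS.
set r := ((m - k) ^ 2 + _)%N.
(* Each summand is thus a signed monomial whose exponent is a square, and squares are 0 or 1 modulo
   4. *)
have : eqm m (q ^+ r * (qbin (q ^+ 2) (m + m) k * euler F 2)) (q ^+ r * 1).
  refine (eqm_le (eqmXnM (k := r) (@eqm_qbin F 2 _ _ isT km)) _).
  exact: gauss_bound.
move/(_ n (ltnSn n)) => er.
have -> : (-1) ^+ (m + k) * qbin (q ^+ 2) (m + m) k * q ^+ r * euler F 2 =
  (-1) ^+ (m + k) * (q ^+ r * (qbin (q ^+ 2) (m + m) k * euler F 2)) by ring.
suff e0 : (q ^+ r * (qbin (q ^+ 2) (m + m) k * euler F 2)) n = 0.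
  by rewrite -signr_odd mulr_sign; case: odd; rewrite ?coef_serN e0 ?oppr0.
rewrite er coef_serXnM coef_ser1; case: ltnP => // rn.
case: eqP => // nr; have {nr rn} nr : n = r by lia.
move: n4; rewrite nr /r; case: (leqP k m) => [km'|/ltnW km'].
  rewrite (_ : k - m = 0)%N ?addn0; last by lia.
  move: (m - k)%N => j; rewrite -modnXm; have := ltn_pmod j (isT : (0 < 4)%N).
  by case: (j %% 4)%N => [|[|[|[]]]].
rewrite (_ : m - k = 0)%N ?add0n; last by lia.
move: (k - m)%N => j; rewrite -modnXm; have := ltn_pmod j (isT : (0 < 4)%N).
by case: (j %% 4)%N => [|[|[|[]]]].
Qed.

(** This is the product of q^n - q^i over i <= 2n with the vanishing factor i = n left out. *)
Lemma prod_jacobi n :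
  \prod_(i < n) (q ^+ n - q ^+ i) * \prod_(i < n) (q ^+ n - q ^+ (n + i.+1)) =
  (-1) ^+ n * q ^+ ('C(n, 2) + n * n) * qprod q n ^+ 2.
Proof.
rewrite (reindex_inj rev_ord_inj) /=.
under eq_bigr => i _.
  have -> : q ^+ n - q ^+ (n - i.+1) = -1 * q ^+ (n - i.+1) * (1 - q ^+ i.+1).
    have -> : q ^+ n = q ^+ (n - i.+1) * q ^+ i.+1.
      by rewrite -exprD; congr (_ ^+ _); have := ltn_ord i; lia.
    by ring.
  over.
rewrite big_split /=.
under [X in _ * X = _]eq_bigr => i _.
  have -> : q ^+ n - q ^+ (n + i.+1) = q ^+ n * (1 - q ^+ i.+1).
    by rewrite exprD; ring.
  over.
rewrite !big_split /= !prodr_const card_ord -/(qprod q n).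
have -> : \prod_(i < n) q ^+ (n - i.+1) = q ^+ 'C(n, 2).
  by rewrite -prod_expr_ord [RHS](reindex_inj rev_ord_inj).
by rewrite exprD exprM; ring.
Qed.

(* Derivative at the root X = q^n of the q-binomial expansion of
   \prod_(i < m) (X - q^i). *)
Lemma jacobi_finite n : let m := n.*2.+1 in
  qprod q n ^+ 2 *+ 2 = \sum_(k < m.+1)
    (-1) ^+ (n + k) * (m%:R - k%:R *+ 2) * qbin q m k * q ^+ ('C(k - n, 2) + 'C((n - k).+1, 2)).
Proof.
move=> m.
pose c k := qbin q m k * q ^+ 'C(k, 2) * (-1) ^+ k.
pose p : {poly series F} := \prod_(i < m) ('X - (q ^+ i)%:P).
have pE : p = \sum_(k < m.+1) c k *: 'X^(m - k).
  have -> : p = \prod_(i < m) ('X + -1 * (q%:P) ^+ i).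
    by apply: eq_bigr => i _; rewrite mulN1r rmorphXn.
  rewrite qbinomial; apply: eq_bigr => k _.
  by rewrite -rmorph_qbin -mul_polyC /c !rmorphM !rmorphXn rmorphN1.
have nm : (n < m)%N by rewrite /m; lia.
pose p' : {poly series F} := \prod_(i < m | i != Ordinal nm) ('X - (q ^+ i)%:P).
have pp' : p = ('X - (q ^+ n)%:P) * p' by rewrite /p (bigD1 (Ordinal nm)).
have p0 : p.[q ^+ n] = 0 by rewrite pp' hornerM hornerXsubC subrr mul0r.
have dp : p^`().[q ^+ n] = p'.[q ^+ n].
  by rewrite pp' derivM derivXsubC mul1r hornerD hornerM hornerXsubC subrr mul0r addr0.
have p'E : p'.[q ^+ n] = (-1) ^+ n * q ^+ ('C(n, 2) + n * n) * qprod q n ^+ 2.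
  rewrite -prod_jacobi /p' horner_prod.
  under eq_bigr do rewrite hornerXsubC.
  transitivity (\prod_(0 <= i < m | i != n) (q ^+ n - q ^+ i)); first by rewrite big_mkord.
  rewrite (@big_cat_nat _ _ _ n) //=; last exact: ltnW.
  congr (_ * _).
    by rewrite big_mkord; apply: eq_bigl => i; rewrite ltn_eqF.
  rewrite big_ltn_cond // eqxx -{1}[n.+1]add0n big_addn big_mkord.
  rewrite (_ : m - n.+1 = n)%N; last by rewrite /m; lia.
  apply: eq_big => i; first by apply/eqP; lia.
  by rewrite addnC addSnnS.
have dpE : q ^+ n * p^`().[q ^+ n] =
    \sum_(k < m.+1) c k * ((m - k)%:R * q ^+ (n * (m - k))).
  rewrite pE raddf_sum horner_sum mulr_sumr; apply: eq_bigr => k _.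
  rewrite /= derivZ derivXn hornerZ hornerMn hornerXn mulrCA; congr (_ * _).
  rewrite -mulr_natl mulrCA; case: (m - k)%N => [|j]; first by rewrite !mul0r.
  by rewrite -exprM -exprD mulnS.
have p0E : \sum_(k < m.+1) c k * q ^+ (n * (m - k)) = 0.
  rewrite -[RHS]p0 pE horner_sum; apply: eq_bigr => k _.
  by rewrite hornerZ hornerXn exprM.
set s := ('C(n, 2) + n * n)%N in p'E.
apply: (@mulXnI _ (n + s)) => /=.
(* As [p] vanishes at q^n, m p(q^n) may be subtracted from twice the derivative term; this turns the
   weight 2 (m - k) into the odd number m - 2k. *)
transitivity ((-1) ^+ n * (q ^+ n * p^`().[q ^+ n] *+ 2 -
    m%:R * \sum_(k < m.+1) c k * q ^+ (n * (m - k)))).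
  rewrite p0E mulr0 subr0 dp p'E exprD -mulrnAr.
  transitivity (((-1) ^+ n * (-1) ^+ n) * (q ^+ n * q ^+ s * (qprod q n ^+ 2 *+ 2)));
    last by ring.
  by rewrite -expr2 sqrr_sign mul1r.
rewrite dpE -sumrMnl mulr_sumr -sumrB !mulr_sumr; apply: eq_bigr => k _.
have km : (k <= m)%N by rewrite -ltnS.
have ek := jacobi_exponent km; rewrite -/m -/s in ek.
have -> : (m - k)%:R = m%:R - k%:R :> series F by rewrite natrB.
transitivity ((-1) ^+ n * (-1) ^+ k * (m%:R - k%:R *+ 2) * qbin q m k *
    q ^+ ('C(k, 2) + n * (m - k))).
  by rewrite /c exprD; ring.
by rewrite ek !exprD; ring.
Qed.

End Theta.

(** * Jacobi's quartic relation and the Eisenstein series of level 2 *)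

Section Support.
Variable F : comNzRingType.
Implicit Types f g : series F.

Lemma coef_serM_support m (P Q R : pred nat) f g :
    (forall n, ~~ P (n %% m)%N -> f n = 0) ->
    (forall n, ~~ Q (n %% m)%N -> g n = 0) ->
    (forall i j, P i -> Q j -> R ((i + j) %% m)%N) ->
  forall n, ~~ R (n %% m)%N -> (f * g) n = 0.
Proof.
move=> fP gQ PQR n nR; rewrite coef_serM big1 // => i _.
case: (boolP (P (i %% m)%N)) => [iP|/fP->]; last by rewrite mul0r.
case: (boolP (Q ((n - i) %% m)%N)) => [iQ|/gQ->]; last by rewrite mulr0.
case/negP: nR; have := PQR _ _ iP iQ.
by rewrite modnDm subnKC // -ltnS.
Qed.

Definition evenpart f : series F := fun n => if odd n then 0 else f n.
Definition oddpart f : series F := fun n => if odd n then f n else 0.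

Lemma evenpartDodd f : evenpart f + oddpart f = f.
Proof.
by apply: seriesP => n; rewrite coef_serD /evenpart /oddpart;
   case: odd; rewrite ?add0r ?addr0.
Qed.

Lemma evenpartBodd f : evenpart f - oddpart f = negsub f.
Proof.
apply: seriesP => n; rewrite coef_serB coef_negsub /evenpart /oddpart -signr_odd.
by case: odd; rewrite ?sub0r ?subr0 ?expr1 ?expr0 ?mulN1r ?mul1r.
Qed.

(* Writing f = a + b with a, b its even and odd parts, the coefficients of a^2
   and b^2 sit at exponents 0 and 2 mod 4, so a^2 - b^2 determines a^2 + b^2. *)
Lemma sum_sqr_negsub f : (forall n, (1 < n %% 4)%N -> f n = 0) ->
  f * negsub f = sqsub f ^+ 2 ->
  f ^+ 2 + negsub f ^+ 2 = 2 * sqsub (negsub f) ^+ 2.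
Proof.
move=> fsupp; set a := evenpart f; set b := oddpart f.
rewrite -(evenpartBodd f) -/a -/b => fE.
have fab : f = a + b by rewrite evenpartDodd.
have {}fE : a ^+ 2 - b ^+ 2 = sqsub (f ^+ 2).
  by rewrite rmorphXn /= -fE {1}fab; ring.
suff -> : sqsub (a - b) ^+ 2 = a ^+ 2 + b ^+ 2 by rewrite {1}fab; ring.
rewrite -rmorphXn /= evenpartBodd -rmorphXn /=.
have an n : (n %% 4 != 0)%N -> a n = 0.
  rewrite /a /evenpart; case: ifP => // on n4; apply: fsupp; lia.
have bn n : (n %% 4 != 1)%N -> b n = 0.
  rewrite /b /oddpart; case: ifP => // on n4; apply: fsupp; lia.
have a2 n : (n %% 4 != 0)%N -> (a ^+ 2) n = 0.
  move=> n4; rewrite expr2.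
  by apply: (coef_serM_support (P := pred1 0%N) (Q := pred1 0%N) (R := pred1 0%N)
            an an _ n4) => i j /= /eqP-> /eqP->.
have b2 n : (n %% 4 != 2)%N -> (b ^+ 2) n = 0.
  move=> n4; rewrite expr2.
  by apply: (coef_serM_support (P := pred1 1%N) (Q := pred1 1%N) (R := pred1 2%N)
            bn bn _ n4) => i j /= /eqP-> /eqP->.
apply: seriesP => n; rewrite coef_sqsub coef_serD.
case: ifP => on; first by rewrite a2 ?b2 ?addr0 //; lia.
have := congr1 (fun g : series F => g n) fE.
rewrite /= coef_serB coef_sqsub on coef_negsub => <-; rewrite -signr_odd.
case: (boolP (odd n./2)) => on2.
  by rewrite a2 ?sub0r ?add0r ?expr1 ?mulN1r ?opprK //; lia.
by rewrite b2 ?subr0 ?addr0 ?mul1r //; lia.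
Qed.

(* Comparing coefficients of degree n, those of sqsub d have degree n / 2. *)
Lemma sqsub_ratio_inj (u v : series F) : u 0%N = 1 -> v 0%N = 1 ->
  u * sqsub v = sqsub u * v -> u = v.
Proof.
move=> u0 v0 uv.
have du0 : (u - v) 0%N = 0 by rewrite coef_serB u0 v0 subrr.
have : sqsub v * (u - v) = v * sqsub (u - v).
  by rewrite rmorphB /= !mulrBr [sqsub v * u]mulrC uv; ring.
move: (u - v) du0 (subrK v u) => d d0 <- dv.
suff -> : d = 0 by rewrite add0r.
apply: seriesP; elim/ltn_ind => -[//|n] IH.
have := congr1 (fun g : series F => g n.+1) dv.
have sv0 : sqsub v 0%N = 1 by [].
rewrite /= !coef_serM big_ord_recl subn0 sv0 mul1r big1 ?addr0; last first.
  by move=> i _; rewrite lift0 IH ?mulr0 //; lia.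
move=> ->; rewrite big1 // => i _; rewrite coef_sqsub; case: ifP; rewrite ?mulr0 // => on.
by rewrite IH ?mulr0 //; lia.
Qed.

Lemma theta_inv (e i : series F) : e * i = 1 -> theta i = - (theta e * i * i).
Proof.
move=> ei; have := congr1 (@theta F) ei; rewrite thetaM theta1 => /eqP.
rewrite addrC addr_eq0 => /eqP h.
transitivity (e * i * theta i); first by rewrite ei mul1r.
by rewrite mulrAC h; ring.
Qed.

Lemma coef_euler11 : euler F 1 1%N = -1.
Proof.
rewrite euler.unlock expr1 qprodS qprod0 mul1r expr1 coef_serB coef_ser1 /= -[ser_q F]mulr1.
by rewrite coef_serXM coef_ser1 sub0r.
Qed.

End Support.


Section Level2.
Variable F : fieldType.
Hypothesis two_neq0 : 2%:R != 0 :> F.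
Local Notation q := (ser_q F).
Local Notation e1 := (euler F 1).
Local Notation e2 := (euler F 2).
Local Notation e4 := (euler F 4).
Local Notation e8 := (euler F 8).
(** An inverse of E_1 is a parameter; those of E_2, E_4 and E_8 follow by q -> q^2. *)
Variable i1 : series F.
Hypothesis e1i1 : e1 * i1 = 1.
Local Notation i2 := (sqsub i1).
Local Notation i4 := (sqsub i2).
Local Notation i8 := (sqsub i4).

Let s1 : sqsub e1 = e2. Proof. exact: sqsub_euler. Qed.
Let s2 : sqsub e2 = e4. Proof. exact: sqsub_euler. Qed.
Let s4 : sqsub e4 = e8. Proof. exact: sqsub_euler. Qed.
Let e2i2 : e2 * i2 = 1. Proof. by rewrite -s1 -rmorphM e1i1 rmorph1. Qed.
Let e4i4 : e4 * i4 = 1. Proof. by rewrite -s2 -rmorphM e2i2 rmorph1. Qed.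
Let e8i8 : e8 * i8 = 1. Proof. by rewrite -s4 -rmorphM e4i4 rmorph1. Qed.

(** [T] and [T'] are theta_4 and theta_3 written as quotients of Euler products. *)
Let T := e1 ^+ 2 * i2.
Let T' := e2 ^+ 5 * i1 ^+ 2 * i4 ^+ 2.

Let negsubT : negsub T = T'.
Proof.
rewrite rmorphM rmorphXn /= negsub_sqsub.
have -> : negsub e1 = e2 ^+ 3 * i1 * i4.
  rewrite -negsub_euler1.
  transitivity ((e1 * i1) * (e4 * i4) * negsub e1); last by ring.
  by rewrite e1i1 e4i4 !mul1r.
transitivity ((e2 * i2) * T'); first by rewrite /T'; ring.
by rewrite e2i2 mul1r.
Qed.

(** With [prodT] this is Gauss's arithmetic-geometric mean step: q -> q^2 sends theta_3^2 and
    theta_4^2 to their two means. *)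
Let sumT : T ^+ 2 + T' ^+ 2 = 2 * sqsub T' ^+ 2.
Proof.
rewrite -negsubT; apply: sum_sqr_negsub.
  apply: coef_square_support; rewrite -mulrA [i2 * _]mulrC.
  by rewrite e2i2 mulr1.
rewrite negsubT /T rmorphM rmorphXn /= s1.
transitivity ((e1 * i1) ^+ 2 * (e2 * i2) * (e2 ^+ 2 * i4) ^+ 2).
  by rewrite /T'; ring.
by rewrite e1i1 e2i2 expr1n !mul1r.
Qed.

Let prodT : T * T' = sqsub T ^+ 2.
Proof.
rewrite /T rmorphM rmorphXn /= s1.
transitivity ((e1 * i1) ^+ 2 * (e2 * i2) * (e2 ^+ 2 * i4) ^+ 2).
  by rewrite /T'; ring.
by rewrite e1i1 e2i2 expr1n !mul1r.
Qed.

(** [X], [Z] and [Y] are the fourth powers of theta_3, theta_4 and theta_2. *)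
Let X := T' ^+ 4.
Let Z := T ^+ 4.
Let Y := 16 * q * e4 ^+ 8 * i2 ^+ 4.

Lemma natr_mulI k (f g : series F) : k%:R != 0 :> F -> k%:R * f = k%:R * g -> f = g.
Proof.
move=> k0 fg; apply: seriesP => n; apply: (mulfI k0).
by rewrite -coef_ser_natM fg coef_ser_natM.
Qed.

Let two_exp_neq0 k : (2 ^ k)%:R != 0 :> F.
Proof. by rewrite natrX expf_neq0. Qed.

Let i10 : i1 0%N = 1.
Proof. by have := coef_serM0 e1 i1; rewrite e1i1 euler0 mul1r coef_ser1 => <-. Qed.

Let T0 : T 0%N = 1.
Proof. by rewrite /T coef_serM0 coef_serX0 euler0 expr1n mul1r coef_sqsub /= i10. Qed.

Let T1 : T 1%N = - 2.
Proof.
rewrite /T coef_serM1 coef_sqsub /= mulr0 add0r coef_sqsub /= i10 mulr1.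
rewrite expr2 coef_serM1 euler0 coef_euler11; ring.
Qed.

Let coefX4 (f : series F) : f 0%N = 1 -> (f ^+ 4) 1%N = 4 * f 1%N.
Proof.
move=> f0; rewrite !exprS expr0 mulr1 !coef_serM1 !coef_serM0 f0; ring.
Qed.

(* Both sides are the unique solution of D^2 = 16 X(q^2) D(q^2) with D = 16 q + ... *)
Lemma jacobi_quartic : X = Y + Z.
Proof.
have sXE : sqsub X = e4 ^+ 20 * i2 ^+ 8 * i8 ^+ 8.
  by rewrite /X /T' !(rmorphXn, rmorphM) /= s2; ring.
have sYE : sqsub Y = 16 * q ^+ 2 * e8 ^+ 8 * i4 ^+ 4.
  by rewrite /Y !(rmorphXn, rmorphM) rmorph_nat /= s4 sqsub_q.
have Y2 : Y ^+ 2 = 16 * sqsub X * sqsub Y.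
  rewrite sXE sYE; symmetry.
  transitivity ((e4 * i4) ^+ 4 * (e8 * i8) ^+ 8 * Y ^+ 2); first by rewrite /Y; ring.
  by rewrite e4i4 e8i8 !expr1n !mul1r.
have D2 : (X - Z) ^+ 2 = 16 * sqsub X * sqsub (X - Z).
  have sX : sqsub X = sqsub T' ^+ 4 by rewrite /X rmorphXn.
  have sZ : sqsub Z = sqsub T ^+ 4 by rewrite /Z rmorphXn.
  rewrite rmorphB /= sZ (_ : sqsub T ^+ 4 = (T * T') ^+ 2); last by rewrite prodT; ring.
  have -> : 16 * sqsub X = 4 * (T ^+ 2 + T' ^+ 2) ^+ 2 by rewrite sumT sX; ring.
  apply: (@natr_mulI (2 ^ 2)%N) => //.
  transitivity ((T ^+ 2 + T' ^+ 2) ^+ 2 * (4 * sqsub X * 4 - 16 * (T * T') ^+ 2));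
    last by ring.
  have -> : 4 * sqsub X = (T ^+ 2 + T' ^+ 2) ^+ 2 by rewrite sumT sX; ring.
  by rewrite /X /Z; ring.
have dE : (X - Z - Y) * (X - Z + Y) = 16 * (sqsub X * sqsub (X - Z - Y)).
  transitivity ((X - Z) ^+ 2 - Y ^+ 2); first by ring.
  by rewrite D2 Y2 [sqsub (_ - Y)]rmorphB /=; ring.
have T'0 : T' 0%N = 1 by rewrite -negsubT coef_negsub T0 expr0 mulr1.
have T'1 : T' 1%N = 2 by rewrite -negsubT coef_negsub T1 expr1 mulN1r opprK.
have D0 : (X - Z) 0%N = 0.
  by rewrite coef_serB /X /Z !coef_serX0 T'0 T0 !expr1n subrr.
have D1 : (X - Z) 1%N = 16.
  by rewrite coef_serB /X /Z !coefX4 // T'1 T1; ring.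
have YE : Y = q * (16 * e4 ^+ 8 * i2 ^+ 4) by rewrite /Y; ring.
have Y0 : Y 0%N = 0 by rewrite YE coef_serXM0.
have Y1 : Y 1%N = 16.
  rewrite YE coef_serXM -mulrA coef_ser_natM coef_serM0 !coef_serX0 euler0.
  by rewrite coef_sqsub /= i10 !expr1n !mulr1.
suff : X - Z - Y = 0.
  by move=> /eqP; rewrite subr_eq0 subr_eq => /eqP.
have G0 : (X - Z + Y) 0%N = 0 by rewrite coef_serD D0 Y0 addr0.
have G1 : (X - Z + Y) 1%N = (2 ^ 5)%:R by rewrite coef_serD D1 Y1 -natrD.
have d0 : (X - Z - Y) 0%N = 0 by rewrite coef_serB D0 Y0 subr0.
have d1 : (X - Z - Y) 1%N = 0 by rewrite coef_serB D1 Y1 subrr.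
move: (X - Z - Y) (X - Z + Y) dE G0 G1 d0 d1 => d g dg g0 g1 d0 d1.
(* Since g = 32 q + ..., degree n + 3 of the left side is 32 d_(n+2) by induction, while the right
   side only involves coefficients of d of index at most (n + 3) / 2. Cancelling 32 requires
   characteristic other than 2. *)
apply: seriesP; elim/ltn_ind => -[//|[//|n]] IH.
have := congr1 (fun f : series F => f n.+3) dg.
rewrite /= coef_ser_natM [(sqsub X * _) _]coef_serM [X in _ = _ * X]big1 ?mulr0; last first.
  move=> i _; rewrite [sqsub d _]coef_sqsub; case: ifP; rewrite ?mulr0 // => _.
  by rewrite IH ?mulr0 //; have := ltn_ord i; lia.
rewrite coef_serM 2!big_ord_recr big1 /= ?add0r; last first.
  by move=> i _; rewrite IH ?mul0r //=.
rewrite subnn g0 mulr0 addr0 subSnn g1 => /eqP.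
by rewrite mulf_eq0 (negPf (two_exp_neq0 5)) orbF => /eqP.
Qed.

Let a := theta e1 * i1.
Let b := theta e2 * i2.
Let c := theta e4 * i4.
Let te1 : theta e1 = a * e1.
Proof. by rewrite /a -mulrA [i1 * _]mulrC e1i1 mulr1. Qed.
Let te2 : theta e2 = b * e2.
Proof. by rewrite /b -mulrA [i2 * _]mulrC e2i2 mulr1. Qed.
Let te4 : theta e4 = c * e4.
Proof. by rewrite /c -mulrA [i4 * _]mulrC e4i4 mulr1. Qed.
Let ti1 : theta i1 = - a * i1.
Proof. by rewrite (theta_inv e1i1) mulNr. Qed.
Let ti2 : theta i2 = - b * i2.
Proof. by rewrite (theta_inv e2i2) mulNr. Qed.
Let ti4 : theta i4 = - c * i4.
Proof. by rewrite (theta_inv e4i4) mulNr. Qed.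
Let sa : 2 * sqsub a = b.
Proof. by rewrite /a /b rmorphM /= mulrA -theta_sqsub s1. Qed.
Let sb : 2 * sqsub b = c.
Proof. by rewrite /b /c rmorphM /= mulrA -theta_sqsub s2. Qed.

Let A := 1 + 24 * b - 24 * a.
Let x := e1 ^+ 16 * i2 ^+ 8.
Let y := q * e2 ^+ 16 * i1 ^+ 8.

(** The logarithmic derivatives of X = Y + Z give X A = (2Y + Z) w and 2 X A(q^2) = (2Z + Y) w with
    the same w = [lY - lZ], while G = (Z + 2Y)^2 and 4 G(q^2) = (2Z + Y)^2. So A^2 / G is unchanged
    by q -> q^2. *)
Lemma sqr_eisenstein2 : A ^+ 2 = x + 64 * y.
Proof.
set G := x + 64 * y.
have a0 : a 0%N = 0 by rewrite /a coef_serM0 coef_theta !mul0r.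
have b0 : b 0%N = 0 by rewrite /b coef_serM0 coef_theta !mul0r.
have i20 : i2 0%N = 1 by rewrite coef_sqsub /= i10.
apply: sqsub_ratio_inj.
- by rewrite coef_serX0 /A coef_serB coef_serD coef_ser1 !coef_ser_natM
     a0 b0 !mulr0 addr0 subr0 expr1n.
- rewrite /G coef_serD /x coef_serM0 !coef_serX0 euler0 i20 !expr1n mulr1.
  by rewrite coef_ser_natM /y -mulrA coef_serXM0 mulr0 addr0.
pose lX := 20 * b - 8 * a - 8 * c.
pose lY := 1 + 8 * c - 4 * b.
pose lZ := 8 * a - 4 * b.
have tX : theta X = lX * X.
  rewrite /X /T' !(thetaX, thetaM) te2 ti1 ti4 /=; rewrite /lX; ring.
have tZ : theta Z = lZ * Z.
  rewrite /Z /T !(thetaX, thetaM) te1 ti2 /=; rewrite /lZ; ring.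
have tY : theta Y = lY * Y.
  rewrite /Y !(thetaX, thetaM) theta_nat theta_q te4 ti2 /=; rewrite /lY; ring.
have lE : X * lX = Y * lY + Z * lZ.
  have := congr1 (@theta F) jacobi_quartic; rewrite raddfD /= tX tY tZ => h.
  by rewrite mulrC h; ring.
(* [A] equals [lX + lY - 2 * lZ], and [lE] eliminates [lX]; [XsA] below is analogous. *)
have XA : X * A = (2 * Y + Z) * (lY - lZ).
  transitivity (X * lX + X * (lY - 2 * lZ)); first by rewrite /A /lX /lY /lZ; ring.
  by rewrite lE jacobi_quartic; ring.
have sA : 2 * sqsub A = 2 + 24 * c - 24 * b.
  have -> : sqsub A = 1 + 24 * sqsub b - 24 * sqsub a.
    by rewrite /A rmorphB rmorphD rmorph1 !rmorphM /= !rmorph_nat.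
  by rewrite -sb -sa; ring.
have XsA : X * (2 * sqsub A) = (2 * Z + Y) * (lY - lZ).
  transitivity (X * (2 * lY - lZ) - X * lX); first by rewrite sA /lX /lY /lZ; ring.
  by rewrite lE jacobi_quartic; ring.
have XY : X * Y = 16 * y.
  transitivity ((e2 * i2) ^+ 4 * (e4 * i4) ^+ 8 * (16 * y)).
    by rewrite /X /T' /Y /y; ring.
  by rewrite e2i2 e4i4 !expr1n !mul1r.
have GE : G = (Z + 2 * Y) ^+ 2.
  transitivity (Z ^+ 2 + 4 * (X * Y)); first by rewrite XY /G /x /Z /T; ring.
  by rewrite jacobi_quartic; ring.
have XZ : X * Z = e2 ^+ 16 * i4 ^+ 8.
  transitivity ((e1 * i1) ^+ 8 * (e2 * i2) ^+ 4 * (e2 ^+ 16 * i4 ^+ 8)).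
    by rewrite /X /T' /Z /T; ring.
  by rewrite e1i1 e2i2 !expr1n !mul1r.
have sGE : 4 * sqsub G = (2 * Z + Y) ^+ 2.
  transitivity (4 * (X * Z) + Y ^+ 2); last by rewrite jacobi_quartic; ring.
  have -> : sqsub G = e2 ^+ 16 * i4 ^+ 8 + 64 * (sqsub q * e4 ^+ 16 * i2 ^+ 8).
    rewrite /G rmorphD (rmorphM _ 64) /= (rmorph_nat (@sqsub F) 64) /x /y.
    by rewrite !(rmorphXn, rmorphM) /= s1 s2.
  by rewrite XZ /Y sqsub_q; ring.
apply: (@natr_mulI (2 ^ 2)%N) => //.
have X0 : (X ^+ 2) 0%N = 1.
  by rewrite /X !coef_serX0 -negsubT coef_negsub T0 expr0 mulr1 !expr1n.
apply: (ser_mulI X0).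
transitivity ((X * A) ^+ 2 * (4 * sqsub G)); first by ring.
rewrite rmorphXn /= XA sGE.
transitivity ((X * (2 * sqsub A)) ^+ 2 * G); last by ring.
by rewrite XsA GE; ring.
Qed.

End Level2.

(** * Power series modulo 7 *)

(** The square of an odd number is 8 t + 1 with t triangular; here t is the exponent attached to the
    weight m - 2k in [jacobi_finite]. *)
Lemma jacobi_weight n k : let m := n.*2.+1 in (k <= m)%N ->
  (m%:Z - k%:Z *+ 2) ^+ 2 = (8 * ('C(k - n, 2) + 'C((n - k).+1, 2)) + 1)%:Z.
Proof.
move=> m km; rewrite {}/m in km *.
have := double_bin2 (k - n); have := double_bin2 (n - k).+1.
case: (leqP k n) => [k_le|k_ge].
  rewrite (_ : k - n = 0)%N; last by lia.
  have -> : n.*2.+1%:Z - k%:Z *+ 2 = (2 * (n - k) + 1)%:Z by lia.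
  by move: (n - k)%N => j; nia.
rewrite (_ : n - k = 0)%N; last by lia.
have -> : n.*2.+1%:Z - k%:Z *+ 2 = 1 - (2 * (k - n))%:Z by lia.
by move: (k - n)%N => j; nia.
Qed.

Section Shift.
Variable F : comNzRingType.
Implicit Types f g u R : series F.

(* The operator q d/dq acting on q^k f instead of f. *)
Definition shifted_theta k f := theta f + k%:R * f.

Lemma coef_shifted_theta k f n : shifted_theta k f n = (n + k)%:R * f n.
Proof. by rewrite /shifted_theta coef_serD coef_theta coef_ser_natM natrD mulrDl. Qed.

Lemma coef_iter_shifted_theta k m f n :
  iter m (shifted_theta k) f n = (n + k)%:R ^+ m * f n.
Proof.
elim: m => [|m IH]; first by rewrite expr0 mul1r.
by rewrite iterS coef_shifted_theta IH exprS mulrA.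
Qed.

(** [R] is the logarithmic derivative of q^k u, so on multiples of [u] the operator acts on the
    cofactor as Theta + R. *)
Lemma shifted_thetaM k u R : shifted_theta k u = R * u ->
  forall g, shifted_theta k (g * u) = (theta g + R * g) * u.
Proof.
move=> uR g; rewrite /shifted_theta thetaM.
transitivity (theta g * u + g * shifted_theta k u); first by rewrite /shifted_theta; ring.
by rewrite uR; ring.
Qed.

Lemma coef_serMz f (z : int) n : (f *~ z) n = f n *~ z.
Proof. by case: z => k; rewrite ?NegzE ?mulrNz ?coef_serN -!pmulrn coef_serMn. Qed.

End Shift.

(* These hypotheses characterize 'F_7, in which ring and rewrite would compute. *)
Section Mod7.
Variable F : fieldType.
Hypothesis char7 : 7%N \in [pchar F].
Hypothesis expr7 : forall z : F, z ^+ 7 = z.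
Local Notation S := (series F).
Local Notation q := (ser_q F).

Let eight_eq1 : 8 = 1 :> F.
Proof. by rewrite (natrD _ 7 1) (pcharf0 char7) add0r. Qed.

Let two_neq0 : 2 != 0 :> F.
Proof. by rewrite -(dvdn_pcharf char7). Qed.

Let seven_eq0 : 7 = 0 :> S.
Proof.
by apply: seriesP => n; rewrite coef_ser_nat (pcharf0 char7) if_same.
Qed.

(** Lets [ring], which does not use the characteristic, prove identities modulo 7: the multiple of 7
    is supplied as the witness [c]. *)
Lemma eq_mod7 (c f g : S) : f = g + 7 * c -> f = g.
Proof. by rewrite seven_eq0 mul0r addr0. Qed.

Lemma frobenius_poly (p : {poly F}) : p ^+ 7 = p \Po 'X^7.
Proof.
have p7 : 7%N \in [pchar {poly F}] by rewrite pchar_poly.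
elim/poly_ind: p => [|p c IH]; first by rewrite comp_poly0 expr0n.
rewrite comp_polyD comp_polyM comp_polyX comp_polyC -IH -exprMn.
have := pFrobenius_autD_comm p7 (mulrC (p * 'X) c%:P).
by rewrite !pFrobenius_autE => ->; rewrite -polyC_exp expr7.
Qed.

Lemma coef_ser_expr7 (f : S) n :
  (f ^+ 7) n = if (7 %| n)%N then f (n %/ 7)%N else 0.
Proof.
have trX k i : (i <= n)%N -> (f ^+ k) i = (trunc n.+1 f ^+ k)`_i.
  elim: k i => [|k IH] i iN; first by rewrite !expr0 coef_ser1 coef1.
  rewrite exprS (@coef_serM_trunc _ _ _ n.+1) // exprS; apply: coef_mul_eq => // j ji.
  by rewrite coef_poly ltnS (leq_trans ji iN) IH // (leq_trans ji iN).
rewrite trX // frobenius_poly coef_comp_poly_Xn //; case: ifP => // _.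
by rewrite coef_poly ltnS leq_div.
Qed.

Local Notation e1 := (euler F 1).
Local Notation e2 := (euler F 2).

(** By Jacobi, E_1^3 carries signed odd weights w at triangular exponents n with w^2 = 8 n + 1.
    Modulo 7 this reads w^2 = n + 1, so (n + 1)^3 w = w^7 = w. *)
Lemma coef_euler_cube n : (n + 1)%:R ^+ 3 * (e1 ^+ 3) n = (e1 ^+ 3) n.
Proof.
(* [jacobi_finite] yields twice the coefficient; the factor 2 is inverted by 4 because 8 = 1. *)
suff h : (n + 1)%:R ^+ 3 * ((e1 ^+ 3) n *+ 2) = (e1 ^+ 3) n *+ 2.
  have c4 (z : F) : z = z *+ 2 *+ 4.
    by rewrite -mulrnA -mulr_natr eight_eq1 mulr1.
  by rewrite [LHS]c4 -mulrnAr h -c4.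
pose m := n.*2.+1.
have E : eqm n.+1 e1 (qprod q n) by rewrite -[q]expr1; apply: eqm_euler; lia.
pose w (k : nat) : int := (-1) ^+ (n + k) * (m%:Z - k%:Z *+ 2).
pose t k := ('C(k - n, 2) + 'C((n - k).+1, 2))%N.
have -> : (e1 ^+ 3) n *+ 2 = \sum_(k < m.+1) (w k)%:~R * (n == t k)%:R.
  rewrite exprSr; have /(_ n (ltnSn n)) -> := eqmM (eqmX 2 E) (@eqmxx F n.+1 e1).
  rewrite -coef_serMn -mulrnAl jacobi_finite mulr_suml coef_ser_sum.
  apply: eq_bigr => k _; have km : (k <= m)%N by rewrite -ltnS.
  rewrite -/m -/(t k).
  have : eqm n.+1 (q ^+ t k * (qbin q m k * e1)) (q ^+ t k * 1).
    have := eqmXnM (k := t k) (@eqm_qbin F 1 _ _ isT km); rewrite expr1 => h.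
    refine (eqm_le h _); rewrite mul1n addnS ltnS; exact: jacobi_bound.
  move=> /(_ n (ltnSn n)) h.
  have -> : (-1) ^+ (n + k) * (m%:R - k%:R *+ 2) * qbin q m k * q ^+ t k * e1 =
      (q ^+ t k * (qbin q m k * e1)) *~ w k.
    rewrite -mulrzr /w rmorphM rmorphXn rmorphN1 rmorphB rmorphMn /= -!pmulrn; ring.
  rewrite coef_serMz h coef_serXnM coef_ser1 -mulrzr mulrC; congr (_ * _).
  case: ltngtP => // [tn|nt]; first by rewrite subn_eq0 leqNgt tn.
  by rewrite -nt subnn.
rewrite mulr_sumr; apply: eq_bigr => k _; case: eqP => [nt|]; rewrite ?mulr0 // !mulr1.
have km : (k <= m)%N by rewrite -ltnS.
have -> : (n + 1)%:R = (w k)%:~R ^+ 2 :> F.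
  rewrite {1}nt -rmorphXn /= /w exprMn sqrr_sign mul1r.
  rewrite jacobi_weight // -/(t k) -pmulrn [LHS]natrD [RHS]natrD natrM.
  by rewrite eight_eq1 mul1r.
by rewrite -exprM -exprSr expr7.
Qed.

Lemma coef_euler_cube_support n : (n %% 7)%N \notin [:: 0; 1; 3]%N -> (e1 ^+ 3) n = 0.
Proof.
move=> n7; have /eqP := coef_euler_cube n; rewrite -subr_eq0 -[X in _ - X]mul1r -mulrBl mulf_eq0.
case/orP => [|/eqP//]; suff /negPf-> : (n + 1)%:R ^+ 3 - 1 != 0 :> F by [].
have -> : (n + 1)%:R = (n %% 7 + 1)%:R :> F.
  by rewrite {1}(divn_eq n 7) !natrD natrM (pcharf0 char7) mulr0 add0r.
have := ltn_pmod n (isT : (0 < 7)%N).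
move: n7; case: (n %% 7)%N => [|[|[|[|[|[|[|]]]]]]] // _ _;
  by rewrite -natrX -[1]/(1%:R) -natrB // -(dvdn_pcharf char7).
Qed.

(** The quotient (Theta^3 u) / u expressed through R = (Theta u) / u. *)
Definition chazy (R : S) := theta (theta R) + 3 * R * theta R + R ^+ 3.

Lemma iter3_shifted_theta k u R : shifted_theta k u = R * u ->
  iter 3 (shifted_theta k) u = chazy R * u.
Proof.
move=> uR; have uM := shifted_thetaM uR.
rewrite /= uR uM uM /chazy raddfD /= thetaM; ring.
Qed.

(** * A Ramanujan-type differential system modulo 7 *)

Section Ramanujan.
Variables A P x y : S.
Hypothesis A0 : A 0%N = 1.
Hypothesis A2 : A ^+ 2 = x + y.
Hypothesis tx : theta x = 5 * (P - A) * x.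
Hypothesis ty : theta y = 5 * (P + 2 * A) * y.
Hypothesis chazy_P : chazy P = 1.
Hypothesis chazy_PA : chazy (P + A) = 1.

Let tA : theta A = - P * A + x - 2 * y.
Proof.
have h : 2 * theta A = 5 * P * A + 5 * (2 * y - x).
  apply: (ser_mulI A0).
  transitivity (theta (A ^+ 2)); first by rewrite thetaX /=; ring.
  rewrite A2 raddfD /= tx ty.
  transitivity (5 * P * (x + y) + 5 * A * (2 * y - x)); first by ring.
  by rewrite -A2; ring.
(* The derivative of A^2 = x + y yields 2 Theta A, and 4 inverts 2 modulo 7. *)
apply: (@eq_mod7 (- theta A + 3 * P * A + 3 * (2 * y - x))).
transitivity (4 * (2 * theta A) - 7 * theta A); first by ring.
by rewrite h; ring.
Qed.

(* The Chazy equations of P and P + A have the same leading term, so their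
   difference is only of first order in P. *)
Let tP : theta P = 3 * P ^+ 2 + 4 * x + 2 * y.
Proof.
have ttA : theta (theta A) = - (theta P * A + P * theta A) + theta x - 2 * theta y.
  rewrite {1}tA raddfB raddfD /= mulNr raddfN /= (theta_natM 2) thetaM; ring.
have h : 2 * theta P = - P ^+ 2 + x - 3 * y.
  apply/eqP; rewrite -subr_eq0; apply/eqP.
  apply: (ser_mulI A0); rewrite mulr0.
  (* The last term is zero; it supplies the relation A^2 = x + y to [ring]. *)
  transitivity (chazy (P + A) - chazy P - A * (A ^+ 2 - (x + y))).
    apply: (@eq_mod7 (- (P * x - 2 * P * y - 4 * A * y))).
    have tD f g : theta (f + g) = theta f + theta g by rewrite raddfD.
    rewrite /chazy !tD ttA tA tx ty; ring.
  by rewrite chazy_PA chazy_P A2 !subrr mulr0 subrr.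
apply: (@eq_mod7 (- P ^+ 2 - 2 * y - theta P)).
transitivity (4 * (2 * theta P) - 7 * theta P); first by ring.
by rewrite h; ring.
Qed.

Let r := x - y.

(** Substituting the first order equations collapses [chazy P] to A (x - y) modulo 7. *)
Let Ar : A * r = 1.
Proof.
rewrite -chazy_P.
have ttP : theta (theta P) = 6 * P * theta P + 4 * theta x + 2 * theta y.
  rewrite {1}tP !raddfD /= (theta_natM 3) (theta_natM 4) (theta_natM 2) thetaX /=; ring.
apply: (@eq_mod7 (- 4 * P ^+ 3 - 8 * P * x - 4 * P * y + 3 * A * r)).
rewrite /chazy ttP tP tx ty /r; ring.
Qed.

Let xE : x = 4 * (A ^+ 2 + r).
Proof. apply: (@eq_mod7 (- x)); rewrite A2 /r; ring. Qed.

Let yE : y = 4 * (A ^+ 2 - r).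
Proof. apply: (@eq_mod7 (- y)); rewrite A2 /r; ring. Qed.

Let tr : theta r = 5 * P * r - 5 * A * (x + 2 * y).
Proof. by rewrite /r raddfB /= tx ty; ring. Qed.

(** Differentiating A r = 1 gives an equation linear in P. *)
Let PE : P = A ^+ 4 + 3 * A + 4 * r ^+ 2.
Proof.
have h : 4 * P = 5 * A ^+ 2 * (x + 2 * y) - (x - 2 * y) * r.
  have := congr1 (@theta F) Ar; rewrite thetaM theta1 tA tr => /eqP.
  have -> : (- P * A + x - 2 * y) * r + A * (5 * P * r - 5 * A * (x + 2 * y)) =
    4 * P * (A * r) + (x - 2 * y) * r - 5 * A ^+ 2 * (x + 2 * y) by ring.
  by rewrite Ar mulr1 -addrA addr_eq0 => /eqP->; ring.
apply: (@eq_mod7 (17 * A ^+ 4 - 5 * A - 4 * r ^+ 2 - P)).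
transitivity (2 * (4 * P) - 7 * P); first by ring.
rewrite h xE yE.
transitivity (120 * A ^+ 4 - 32 * A * (A * r) - 24 * r ^+ 2 - 7 * P); first by ring.
by rewrite Ar; ring.
Qed.

Let tA' : theta A = r - A ^+ 5.
Proof.
apply: (@eq_mod7 (r - A ^+ 2)); rewrite tA PE xE yE.
transitivity (- A ^+ 5 - 4 * r * (A * r) - 7 * A ^+ 2 + 12 * r); first by ring.
by rewrite Ar; ring.
Qed.

(** The remaining computation takes place in F_7[B, 1/B], with [D] = 1/B, which is stable under
    Theta by [tB] and [tD]. *)
Let B := A ^+ 2.
Let D := r ^+ 2.

Let DB : D * B = 1.
Proof. by rewrite /D /B -exprMn mulrC Ar expr1n. Qed.

Let tB : theta B = 2 - 2 * B ^+ 3.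
Proof.
rewrite /B thetaX tA' /=; transitivity (2 * (A * r) - 2 * (A ^+ 2) ^+ 3); first by ring.
by rewrite Ar mulr1.
Qed.

Let tD : theta D = 2 * B - 2 * D ^+ 2.
Proof.
have trE : theta r = A ^+ 3 - r ^+ 3.
  apply: (ser_mulI A0).
  have := congr1 (@theta F) Ar; rewrite thetaM theta1 addrC => /eqP.
  rewrite addr_eq0 => /eqP->; rewrite tA'.
  transitivity (A ^+ 4 * (A * r) - r ^+ 2); first by ring.
  rewrite Ar; transitivity (A ^+ 4 - (A * r) * r ^+ 2); last by ring.
  by rewrite Ar; ring.
rewrite /D thetaX trE /=.
transitivity (2 * A ^+ 2 * (A * r) - 2 * (r ^+ 2) ^+ 2); first by ring.
by rewrite Ar mulr1.
Qed.

(** As [eq_mod7], with [d] the multiplier of the relation D B = 1. *)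
Let eq_modDB (c d f g : S) : f = g + 7 * c + (D * B - 1) * d -> f = g.
Proof. by rewrite DB subrr mul0r addr0; apply: eq_mod7. Qed.

Let xyE : x * y * (x + y) ^+ 7 = 2 * B ^+ 9 - 2 * B ^+ 6.
Proof.
rewrite -A2 -/B xE yE; apply: (@eq_modDB (2 * B ^+ 9 - 2 * B ^+ 6) (- 16 * B ^+ 6)).
rewrite /B /D; ring.
Qed.

(** The iterates are computed one by one as cofactors of f in F_7[B, 1/B]. The sixth is 1 + 2 B^6 +
    5 B^9, which is 1 - x y (x + y)^7 by [xyE]. *)
Lemma iter6_shifted_theta f : shifted_theta 6 f = (4 * P + 2 * A) * f ->
  f - iter 6 (shifted_theta 6) f = x * y * (x + y) ^+ 7 * f.
Proof.
have -> : 4 * P + 2 * A = 4 * B ^+ 2 + 2 * D.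
  by apply: (@eq_mod7 (2 * A + 2 * D)); rewrite PE /B /D; ring.
move=> f1; have fM := shifted_thetaM f1.
have tBX k : theta (B ^+ k) = k%:R * B ^+ k.-1 * (2 - 2 * B ^+ 3) by rewrite thetaX tB.
(* Generalizing [B] and [D] to variables keeps [ring] from expanding them in terms of [A] and
   [r]. *)
rewrite xyE; move: (tB) (tD) (@eq_modDB); move: B D tBX f1 fM => b d tbX f1 fM tb td eqm.
have f2 : shifted_theta 6 ((4 * b ^+ 2 + 2 * d) * f) = b * f.
  rewrite fM raddfD /= (theta_natM 4) (theta_natM 2) tbX td /=.
  by apply: (eqm (5 * b * f) (16 * b * f)); ring.
have f3 : shifted_theta 6 (b * f) = (2 * b ^+ 3 + 4) * f.
  rewrite fM tb; by apply: (eqm 0 (2 * f)); ring.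
have f4 : shifted_theta 6 ((2 * b ^+ 3 + 4) * f) = (4 * b ^+ 2 + 3 * b ^+ 5 + d) * f.
  rewrite fM raddfD /= (theta_natM 2) (theta_nat F 4) tbX /=.
  by apply: (eqm ((4 * b ^+ 2 - b ^+ 5 + d) * f) (4 * b ^+ 2 * f)); ring.
have f5 : shifted_theta 6 ((4 * b ^+ 2 + 3 * b ^+ 5 + d) * f) =
    (2 * b + b ^+ 4 + 3 * b ^+ 7) * f.
  rewrite fM !raddfD /= (theta_natM 4) (theta_natM 3) !tbX td /=.
  by apply: (eqm ((4 * b + 5 * b ^+ 4 - 3 * b ^+ 7) * f) ((12 * b + 6 * b ^+ 4) * f)); ring.
have f6 : shifted_theta 6 ((2 * b + b ^+ 4 + 3 * b ^+ 7) * f) =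
    (1 + 2 * b ^+ 6 + 5 * b ^+ 9) * f.
  rewrite fM !raddfD /= (theta_natM 2) (theta_natM 3) !tbX tb /=.
  by apply: (eqm ((1 + 2 * b ^+ 3 + 6 * b ^+ 6 - 5 * b ^+ 9) * f)
    ((4 + 2 * b ^+ 3 + 6 * b ^+ 6) * f)); ring.
rewrite /= f1 f2 f3 f4 f5 f6.
by apply: (@eq_mod7 (- b ^+ 9 * f)); ring.
Qed.

End Ramanujan.

(** * Euler products modulo 7 and the exponents 1 mod 7 of 1 / (E_1 E_2) *)

Variable i1 : S.
Hypothesis e1i1 : e1 * i1 = 1.
Local Notation i2 := (sqsub i1).
Let e2i2 : e2 * i2 = 1.
Proof. by rewrite -(@sqsub_euler F 1) // -rmorphM e1i1 rmorph1. Qed.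

Let a := theta e1 * i1.
Let b := theta e2 * i2.
Let te1 : theta e1 = a * e1.
Proof. by rewrite /a -mulrA [i1 * _]mulrC e1i1 mulr1. Qed.
Let te2 : theta e2 = b * e2.
Proof. by rewrite /b -mulrA [i2 * _]mulrC e2i2 mulr1. Qed.
Let ti1 : theta i1 = - a * i1.
Proof. by rewrite (theta_inv e1i1) mulNr. Qed.
Let ti2 : theta i2 = - b * i2.
Proof. by rewrite (theta_inv e2i2) mulNr. Qed.

Let P := 1 + 3 * a.
Let A := 1 + 3 * b - 3 * a.
Let x := e1 ^+ 16 * i2 ^+ 8.
Let y := q * e2 ^+ 16 * i1 ^+ 8.

Let A2 : A ^+ 2 = x + y.
Proof.
have h : (1 + 24 * b - 24 * a) ^+ 2 = x + 64 * y := sqr_eisenstein2 two_neq0 e1i1.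
transitivity ((1 + 24 * b - 24 * a) ^+ 2).
  apply: (@eq_mod7 (- 2 * (3 * b - 3 * a) * A - 7 * (3 * b - 3 * a) ^+ 2 * 1)); rewrite /A; ring.
rewrite h; apply: (@eq_mod7 (9 * y)); ring.
Qed.

Let A0 : A 0%N = 1.
Proof.
rewrite /A coef_serB coef_serD !coef_ser_natM coef_ser1 /a /b !coef_serM0.
by rewrite !coef_theta !mul0r !mulr0 addr0 subr0.
Qed.

Let tx : theta x = 5 * (P - A) * x.
Proof.
rewrite /x !(thetaX, thetaM) te1 ti2 /=.
apply: (@eq_mod7 ((b - 2 * a) * x)); rewrite /P /A /x; ring.
Qed.

Let ty : theta y = 5 * (P + 2 * A) * y.
Proof.
rewrite /y !(thetaX, thetaM) te2 ti1 theta_q /=.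
apply: (@eq_mod7 ((- 2 + a - 2 * b) * y)); rewrite /P /A /y; ring.
Qed.

(** Because 24 = 3 modulo 7, P and P + A are the logarithmic derivatives of q E_1^3 and q^2 E_2^3,
    so that Jacobi's identity controls both. *)
Let shifted_euler1 : shifted_theta 1 (e1 ^+ 3) = P * e1 ^+ 3.
Proof. rewrite /shifted_theta thetaX te1 /P /=; ring. Qed.

Let shifted_euler2 : shifted_theta 2 (e2 ^+ 3) = (P + A) * e2 ^+ 3.
Proof. rewrite /shifted_theta thetaX te2 /P /A /=; ring. Qed.

Let chazy_P : chazy P = 1.
Proof.
have e10 : (e1 ^+ 3) 0%N = 1 by rewrite coef_serX0 euler0 expr1n.
apply: (ser_mulI e10); rewrite mulr1 mulrC -(iter3_shifted_theta shifted_euler1).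
by apply: seriesP => n; rewrite coef_iter_shifted_theta coef_euler_cube.
Qed.

Let chazy_PA : chazy (P + A) = 1.
Proof.
have e20 : (e2 ^+ 3) 0%N = 1 by rewrite coef_serX0 euler0 expr1n.
apply: (ser_mulI e20); rewrite mulr1 mulrC -(iter3_shifted_theta shifted_euler2).
apply: seriesP => n; rewrite coef_iter_shifted_theta.
have -> : e2 ^+ 3 = sqsub (e1 ^+ 3) by rewrite rmorphXn /= sqsub_euler.
rewrite coef_sqsub.
case: ifP => on; rewrite ?mulr0 // -[RHS]coef_euler_cube.
(* The substitution q -> q^2 doubles exponents, and 2^3 = 1 keeps their cubes equal to 1. *)
rewrite (_ : n + 2 = 2 * (n./2 + 1))%N; last by lia.
have two3 : 2 ^+ 3 = 1 :> F by rewrite -natrX.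
by rewrite natrM exprMn two3 mul1r.
Qed.

Let f := (e1 * e2) ^+ 6.
Let h := e1 ^+ 3 * (e1 ^+ 2 * i2) ^+ 7 + q * (e2 ^+ 3 * (e2 ^+ 2 * i1) ^+ 7).

Let residue_f : f - iter 6 (shifted_theta 6) f = q * ((e1 * e2) ^+ 7 * h ^+ 7).
Proof.
have f1 : shifted_theta 6 f = (4 * P + 2 * A) * f.
  rewrite /shifted_theta /f thetaX thetaM te1 te2 /P /A /=; ring.
rewrite (iter6_shifted_theta A0 A2 tx ty chazy_P chazy_PA f1).
have xy : x * y = q * (e1 * e2) ^+ 8.
  transitivity ((e1 * i1) ^+ 8 * (e2 * i2) ^+ 8 * (q * (e1 * e2) ^+ 8)).
    by rewrite /x /y; ring.
  by rewrite e1i1 e2i2 !expr1n !mul1r.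
have hE : h = e1 * e2 * (x + y).
  transitivity ((e2 * i2) * (e1 ^+ 17 * i2 ^+ 7) + (e1 * i1) * (q * e2 ^+ 17 * i1 ^+ 7)).
    by rewrite e1i1 e2i2 !mul1r /h; ring.
  by rewrite /x /y; ring.
rewrite xy hE /f; ring.
Qed.

(* q d/dq shifted by 6 kills the exponents 1 mod 7 of (e1 e2)^6, and
   1 / (e1 e2)^7 has exponents 0 mod 7 only. *)
Lemma coef_cubic k : (i1 * i2) (7 * k + 1)%N = h k.
Proof.
pose g := iter 6 (shifted_theta 6) f.
have fE : f = g + q * ((e1 * e2) ^+ 7 * h ^+ 7) by rewrite -residue_f addrC subrK.
have -> : i1 * i2 = g * (i1 * i2) ^+ 7 + q * h ^+ 7.
  transitivity (f * (i1 * i2) ^+ 7).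
    transitivity (((e1 * i1) * (e2 * i2)) ^+ 6 * (i1 * i2)); last by rewrite /f; ring.
    by rewrite e1i1 e2i2 mul1r expr1n mul1r.
  rewrite {1}fE.
  transitivity (g * (i1 * i2) ^+ 7 + ((e1 * i1) * (e2 * i2)) ^+ 7 * (q * h ^+ 7)); first by ring.
  by rewrite e1i1 e2i2 mul1r expr1n mul1r.
(* By Frobenius, degree 7k + 1 of q h^7 is h_k; the term in [g] has no exponent 1 mod 7. *)
rewrite coef_serD addn1 coef_serXM coef_ser_expr7 dvdn_mulr // mulKn //.
rewrite (coef_serM_support (m := 7) (P := (fun i => i %% 7 != 1)%N) (Q := pred1 0%N)
  (R := predC1 1%N)) ?add0r //.
- move=> n; rewrite negbK modn_mod => /eqP n1; rewrite /g coef_iter_shifted_theta.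
  have -> : (n + 6)%:R = 0 :> F by apply/eqP; rewrite -(dvdn_pcharf char7); lia.
  by rewrite expr0n mul0r.
- by move=> n /= n0; rewrite coef_ser_expr7 /dvdn (negPf n0).
- by move=> i j /= i1' /eqP->; lia.
by rewrite /= negbK; lia.
Qed.

Lemma coef_cubic_eq0 n r : (r \in [:: 2; 4; 5; 6])%N -> (i1 * i2) (49 * n + (7 * r + 1))%N = 0.
Proof.
move=> r7; rewrite (_ : 49 * n + _ = 7 * (7 * n + r) + 1)%N; last by lia.
have r_lt7 : (r < 7)%N by move: r7; rewrite !inE; lia.
have T7 (g : S) m : (m %% 7 != 0)%N -> (g ^+ 7) m = 0.
  by move=> m0; rewrite coef_ser_expr7 /dvdn (negPf m0).
have suppM (s : seq nat) (g1 g2 : S) m : {in s, forall i, i < 7}%N ->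
    (forall m, (m %% 7)%N \notin s -> g1 m = 0) ->
    (m %% 7)%N \notin s -> (g1 * g2 ^+ 7) m = 0.
  move=> s7 g1s; apply: (coef_serM_support (P := mem s) (Q := pred1 0%N) (R := mem s)) => //=.
    exact: T7.
  by move=> i j si /eqP->; rewrite addn0 modn_small ?s7.
rewrite coef_cubic /h coef_serD (suppM [:: 0; 1; 3]%N) ?add0r //.
- have -> : (7 * n + r = (7 * n + r.-1).+1)%N by move: r7; rewrite !inE; lia.
  (* The residues of E_2^3 are the doubles of 0, 1, 3; the factor q moves them to 1, 3, 0, the same
     set as for the first term. *)
  rewrite coef_serXM (suppM [:: 0; 2; 6]%N) // => [i|m m7|].
  - by rewrite !inE; lia.
  - have -> : e2 ^+ 3 = sqsub (e1 ^+ 3) by rewrite rmorphXn /= sqsub_euler.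
    rewrite coef_sqsub; case: ifP => // om; apply: coef_euler_cube_support.
    by move: m7; rewrite !inE; lia.
  by move: r7; rewrite !inE; lia.
- by move=> i; rewrite !inE; lia.
- exact: coef_euler_cube_support.
by move: r7; rewrite !inE; lia.
Qed.

End Mod7.

(** * Reduction of integer coefficients to F_7 *)

Lemma qpoch_euler d n : (qpoch d n)%:~R = euler 'F_7 d n.
Proof.
rewrite euler.unlock -ser_of_polyXn -rmorph_qprod /qpoch /qprod /ser_of_poly.
rewrite -(coef_map (intmul 1 : int -> 'F_7)) rmorph_prod big_add1 big_mkord.
congr (_ _ n); congr (polyseq _); apply: eq_bigr => i _.
by rewrite rmorphB rmorph1 /= map_polyXn -exprM.
Qed.

Lemma eq0_mod7 (z : int) : z%:~R = 0 :> 'F_7 -> (z = 0 %[mod 7])%Z.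
Proof.
move=> z0; apply/eqP; rewrite eqz_mod_dvd subr0.
by rewrite (dvdz_pcharf (pchar_Fp (isT : prime 7))) z0.
Qed.

Theorem theorem1p4 (n : nat) :
  [/\ (cubic_partitions (49 * n + 15)%N = 0 %[mod 7])%Z,
      (cubic_partitions (49 * n + 29)%N = 0 %[mod 7])%Z,
      (cubic_partitions (49 * n + 36)%N = 0 %[mod 7])%Z
    & (cubic_partitions (49 * n + 43)%N = 0 %[mod 7])%Z].
Proof.
pose C : series 'F_7 := fun k => (cubic_partitions k)%:~R.
have e12C : euler 'F_7 1 * euler 'F_7 2 * C = 1.
  apply: seriesP => k; rewrite coef_ser1.
  have -> : (k == 0)%:R = (fps_one k)%:~R :> 'F_7 by rewrite /fps_one; case: eqP.
  rewrite -cubic_partitionsP /fps_mul coef_serM rmorph_sum; apply: eq_bigr => i _.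
  rewrite rmorphM coef_serM rmorph_sum; congr (_ * _); apply: eq_bigr => j _.
  by rewrite rmorphM /= !qpoch_euler.
pose i1 := euler 'F_7 2 * C.
have e1i1 : euler 'F_7 1 * i1 = 1 by rewrite mulrA.
have CE : i1 * sqsub i1 = C.
  have e2i2 : euler 'F_7 2 * sqsub i1 = 1.
    by rewrite -(@sqsub_euler _ 1) // -rmorphM e1i1 rmorph1.
  by rewrite /i1 mulrAC e2i2 mul1r.
have char7 : 7%N \in [pchar 'F_7] by rewrite pchar_Fp.
have expr7 (z : 'F_7) : z ^+ 7 = z by have := expf_card z; rewrite card_Fp.
have C0 r := @coef_cubic_eq0 _ char7 expr7 _ e1i1 n r.
rewrite CE in C0.
split; apply: eq0_mod7.
(* For r = 2, 4, 5, 6 the offset 7 r + 1 is 15, 29, 36, 43. *)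
- exact: (C0 2%N).
- exact: (C0 4%N).
- exact: (C0 5%N).
exact: (C0 6%N).
Qed.
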